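(* Let $F$ be a field of characteristic zero, and let $A_1,A_1^*,A_2,\mathcal{G}_4$ be the $F$-algebras defined in the context. Then, for all $n$ large enough: 1) $\chi_n^z(A_2\oplus A_1)=\chi_n^z(A_2\oplus A_1^* )=\chi_{(n)}+\chi_{(n-1,1)}$. 2) $\chi_n^z(\mathcal{G}_4\oplus A_1)=\chi_n^z(\mathcal{G}_4\oplus A_1^* )=\chi_{(n)}+\chi_{(n-1,1)}+\chi_{(n-2,1^2)}$. 3) $l_n^z(A_2\oplus A_1)=l_n^z(A_2\oplus A_1^* )=l_n^\delta(A_2\oplus A_1)=l_n^\delta(A_2\oplus A_1^* )=2$. 4) $l_n^z(\mathcal{G}_4\oplus A_1)=l_n^z(\mathcal{G}_4\oplus A_1^* )=l_n^\delta(\mathcal{G}_4\oplus A_1)=l_n^\delta(\mathcal{G}_4\oplus A_1^* )=3$.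
   Context: With $e_{ij}$ matrix units: $A_1=Fe_{11}+Fe_{12}$ and $A_1^*=Fe_{22}+Fe_{12}$ ($2\times2$ matrices), $A_2=F(e_{11}+e_{22}+e_{33})+Fe_{12}+Fe_{13}+Fe_{23}$ ($3\times3$ matrices). $\mathcal{G}_4$ is the unital Grassmann algebra over $F$ generated by $1,e_1,e_2,e_3,e_4$ with $e_ie_j=-e_je_i$ for all $i,j$ (in particular $e_i^2=0$). For an associative $F$-algebra $A$ (not necessarily unital) with center $Z(A)$, $\mathrm{Id}(A)$ is the T-ideal of polynomial identities of $A$ in the free associative algebra $F\langle x_1,x_2,\ldots\rangle$, and $\mathrm{Id}^z(A)$ is the set of polynomials all of whose evaluations on $A$ lie in $Z(A)$. $P_n$ is the space of multilinear polynomials of degree $n$ in $x_1,\ldots,x_n$, with $S_n$ acting by permuting variables. $\chi_n^z(A)$ is the $S_n$-character of $P_n/(P_n\cap\mathrm{Id}^z(A))$ and $\chi_n^\delta(A)$ is the $S_n$-character of $(P_n\cap\mathrm{Id}^z(A))/(P_n\cap\mathrm{Id}(A))$. $\chi_\lambda$ is the irreducible $S_n$-character of the partition $\lambda\vdash n$. $l_n^z(A)$ and $l_n^\delta(A)$ are the sums of the multiplicities of the irreducible characters in $\chi_n^z(A)$ and $\chi_n^\delta(A)$, respectively. *)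

(* Defs.v *)
From HB Require Import structures.
From mathcomp Require Import all_boot all_order all_fingroup all_algebra.
From mathcomp Require Import falgebra mxrepresentation.
From mathcomp Require Import boolp.
From mathcomp Require classical_sets.
From mathcomp Require Import ring.

Set Implicit Arguments.
Unset Strict Implicit.
Unset Printing Implicit Defensive.

Import GRing.Theory.
Local Open Scope ring_scope.

(* An associative F-algebra, not necessarily unital: a linear subspace of a   *)
(* unital algebra that is closed under multiplication. Identities and the     *)
(* center below only involve the elements of the subspace.                    *)
Record subalg (F : fieldType) := Subalg {
  ambient : algType F;
  elts : {pred ambient};
  elts_submod : GRing.submod_closed elts;
  elts_mul : GRing.mulr_2closed elts
}.
Arguments elts {F} s.

Section Basic.

Variable F : fieldType.
Implicit Types A B : subalg F.

Definition in_center A (z : ambient A) : Prop :=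
  z \in elts A /\ {in elts A, forall b, z * b = b * z}.

Definition dsum_elts A B : {pred ambient A * ambient B} :=
  [pred x | (x.1 \in elts A) && (x.2 \in elts B)].

Arguments dsum_elts : clear implicits.

Lemma dsum_submod A B : GRing.submod_closed (dsum_elts A B).
Proof.
have [A0 AL] := elts_submod A; have [B0 BL] := elts_submod B.
split=> [|a u v]; first by rewrite inE A0 B0.
rewrite !inE => /andP[u1 u2] /andP[v1 v2].
by apply/andP; split; [apply: AL | apply: BL].
Qed.

Lemma dsum_mul A B : GRing.mulr_2closed (dsum_elts A B).
Proof.
move=> u v; rewrite !inE => /andP[u1 u2] /andP[v1 v2].
by rewrite !elts_mul.
Qed.

Definition dsum A B : subalg F := Subalg (@dsum_submod A B) (@dsum_mul A B).

Lemma vspace_submod (V : vectType F) (U : {vspace V}) : GRing.submod_closed [pred x in U].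
Proof. by split=> [|a u v Uu Uv]; rewrite inE ?mem0v ?memvD ?memvZ. Qed.

Lemma span_mul (R : falgType F) (X : seq R) :
  all (fun x => all (fun y => x * y \in <<X>>%VS) X) X ->
  GRing.mulr_2closed [pred x in <<X>>%VS].
Proof.
move=> XX'; pose T := in_tuple X.
have XX x y : x \in X -> y \in X -> x * y \in <<X>>%VS.
  by move=> Xx Xy; apply: (allP (allP XX' x Xx) y Xy).
have XT (i : 'I_(size X)) : T`_i \in X by rewrite mem_nth.
move=> u v; rewrite !inE => Uu Uv.
rewrite (coord_span (Uu : u \in <<T>>%VS)) (coord_span (Uv : v \in <<T>>%VS)).
rewrite mulr_suml memv_suml // => i _; rewrite mulr_sumr memv_suml // => j _.
by rewrite -scalerAr -scalerAl !memvZ ?XX.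
Qed.

(* Matrix units, with indices counted from 1. *)
Definition munit m (i j : nat) : 'M[F]_m.+1 := delta_mx (inord i.-1) (inord j.-1).

Lemma munitM m i j k l : (0 < j <= m.+1)%N -> (0 < k <= m.+1)%N ->
  munit m i j * munit m k l = if j == k then munit m i l else 0.
Proof.
move=> /andP[j0 jm] /andP[k0 km].
have -> : munit m i j * munit m k l = munit m i j *m munit m k l by [].
rewrite /munit; case: eqVneq => [->|njk]; first by rewrite mul_delta_mx.
rewrite mul_delta_mx_0 //; apply: contra njk => /eqP/(congr1 (@nat_of_ord _)).
by rewrite !inordK ?prednK // => jk; rewrite -(prednK j0) jk prednK.
Qed.

Definition A1_gen : seq 'M[F]_2 := [:: munit 1 1 1; munit 1 1 2].
Definition A1s_gen : seq 'M[F]_2 := [:: munit 1 2 2; munit 1 1 2].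
Definition A2_gen : seq 'M[F]_3 :=
  [:: munit 2 1 1 + munit 2 2 2 + munit 2 3 3;
      munit 2 1 2; munit 2 1 3; munit 2 2 3].

Lemma A1_mul : GRing.mulr_2closed [pred x in <<A1_gen>>%VS].
Proof.
apply: span_mul; rewrite /= !munitM //= !mem0v !andbT.
by repeat (apply/andP; split); apply: memv_span; rewrite !inE eqxx ?orbT.
Qed.

Lemma A1s_mul : GRing.mulr_2closed [pred x in <<A1s_gen>>%VS].
Proof.
apply: span_mul; rewrite /= !munitM //= !mem0v !andbT.
by repeat (apply/andP; split); apply: memv_span; rewrite !inE eqxx ?orbT.
Qed.

Lemma A2_mul : GRing.mulr_2closed [pred x in <<A2_gen>>%VS].
Proof.
apply: span_mul; rewrite /= !mulrDl !mulrDr !munitM //= ?(addr0, add0r, mem0v).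
by repeat (apply/andP; split) => //; apply: memv_span; rewrite !inE eqxx ?orbT.
Qed.

Definition A1 : subalg F := Subalg (vspace_submod <<A1_gen>>%VS) A1_mul.
Definition A1s : subalg F := Subalg (vspace_submod <<A1s_gen>>%VS) A1s_mul.
Definition A2 : subalg F := Subalg (vspace_submod <<A2_gen>>%VS) A2_mul.

End Basic.

(* The unital Grassmann algebra on m generators: x : grassmann F m stands for *)
(* \sum_S x S *: e_S, where e_S is the product of the generators indexed by S *)
(* in increasing order. Thus e_S * e_T is 0 if S and T meet, and otherwise    *)
(* (-1) ^+ (inversions S T) *: e_(S :|: T).                                   *)
Definition grassmann (F : fieldType) (m : nat) := {ffun {set 'I_m} -> F^o}.

Section Grassmann.

Variables (F : fieldType) (m : nat).
Local Notation G := (grassmann F m).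
Implicit Types (x y z : G) (S T U V : {set 'I_m}).

HB.instance Definition _ := GRing.Lmodule.copy G {ffun {set 'I_m} -> F^o}.

Definition inversions S T : nat := \sum_(i in S) \sum_(j in T) (j < i)%N.

Definition grassmann_one : G := [ffun S => (S == set0)%:R].

Definition grassmann_mul x y : G :=
  [ffun U : {set 'I_m} => \sum_(S : {set 'I_m} | S \subset U)
     (-1) ^+ inversions S (U :\: S) * x S * y (U :\: S)].

Lemma inversionsD S T U V : S \subset V -> V \subset U ->
  (inversions S (V :\: S) + inversions V (U :\: V)
   = inversions S (U :\: S) + inversions (V :\: S) (U :\: V))%N.
Proof.
move=> sSV sVU; rewrite /inversions.
rewrite (big_setID S (A := V)) /= (setIidPr sSV) addnA; congr (_ + _)%N.
rewrite -big_split; apply: eq_bigr => i _ /=.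
rewrite (big_setID V (A := U :\: S)) /=; congr (_ + _)%N; apply: eq_bigl => j.
  rewrite !inE; have /implyP := subsetP sVU j.
  by case: (j \in S); case: (j \in V); case: (j \in U).
rewrite !inE; have /implyP := subsetP sSV j.
by case: (j \in S); case: (j \in V); case: (j \in U).
Qed.

Lemma grassmann_mulA : associative grassmann_mul.
Proof.
move=> x y z; apply/ffunP => U; rewrite !ffunE; symmetry.
transitivity (\sum_(V : {set 'I_m} | V \subset U) \sum_(S : {set 'I_m} | S \subset V)
   ((-1) ^+ (inversions S (U :\: S) + inversions (V :\: S) (U :\: V)) : F) *
   (x S * (y (V :\: S) * z (U :\: V)))).
  apply: eq_bigr => V sVU; rewrite ffunE mulr_sumr mulr_suml.
  apply: eq_bigr => S sSV; rewrite -inversionsD // exprD.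
  by set a := _ ^+ _; set b := _ ^+ _; rewrite -/(a : F) -/(b : F); ring.
rewrite (exchange_big_dep (fun S => S \subset U)) /=; last first.
  by move=> V S sVU sSV; apply: subset_trans sSV sVU.
apply: eq_bigr => S sSU; rewrite ffunE mulr_sumr.
rewrite (reindex_onto (fun T => S :|: T) (fun V => V :\: S)) /=; last first.
  by move=> V /andP[_ sSV]; rewrite setDE setUIr setUCr setIT; apply/setUidPr.
have E T : (S :|: T) :\: S = T :\: S by rewrite setDUl setDv set0U.
apply: eq_big => [T|T].
  rewrite subUset sSU subsetUl E andbT subsetD; congr (_ && _).
  by apply/eqP/setDidPl.
rewrite E => /andP[_ /eqP ->]; rewrite setDDl exprD.
by set a := _ ^+ _; set b := _ ^+ _; rewrite -/(a : F) -/(b : F); ring.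
Qed.

Lemma grassmann_mul1l : left_id grassmann_one grassmann_mul.
Proof.
move=> x; apply/ffunP => U; rewrite ffunE (bigD1 set0) ?sub0set //= big1.
  by rewrite ffunE eqxx setD0 /inversions big_set0 !mul1r addr0.
by move=> S /andP[_ /negPf nS0]; rewrite ffunE nS0 mulr0 mul0r.
Qed.

Lemma grassmann_mul1r : right_id grassmann_one grassmann_mul.
Proof.
move=> x; apply/ffunP => U; rewrite ffunE (bigD1 U) //= big1 => [|S].
  rewrite ffunE setDv eqxx mulr1 addr0 /inversions big1 ?mul1r // => i _.
  by rewrite big_set0.
move=> /andP[sSU nSU]; rewrite ffunE setD_eq0.
have /negPf-> : ~~ (U \subset S) by apply: contra nSU => sUS; rewrite eqEsubset sSU.
by rewrite mulr0.
Qed.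

Lemma grassmann_mulDl : left_distributive grassmann_mul +%R.
Proof.
move=> x y z; apply/ffunP => U; rewrite !ffunE -big_split; apply: eq_bigr => S _.
by rewrite ffunE mulrDr mulrDl.
Qed.

Lemma grassmann_mulDr : right_distributive grassmann_mul +%R.
Proof.
move=> x y z; apply/ffunP => U; rewrite !ffunE -big_split; apply: eq_bigr => S _.
by rewrite ffunE mulrDr.
Qed.

Lemma grassmann_oner_neq0 : grassmann_one != 0.
Proof. by apply/eqP => /ffunP/(_ set0)/eqP; rewrite !ffunE eqxx oner_eq0. Qed.

HB.instance Definition _ := GRing.Zmodule_isNzRing.Build G
  grassmann_mulA grassmann_mul1l grassmann_mul1r
  grassmann_mulDl grassmann_mulDr grassmann_oner_neq0.

Lemma grassmann_scaleAl (a : F) (x y : G) : a *: (x * y) = (a *: x) * y.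
Proof.
apply/ffunP => U; rewrite !ffunE scaler_sumr; apply: eq_bigr => S _.
by rewrite ffunE /GRing.scale /= mulrA mulrCA !mulrA.
Qed.

HB.instance Definition _ :=
  GRing.Lmodule_isLalgebra.Build F G grassmann_scaleAl.

Lemma grassmann_scaleAr (a : F) (x y : G) : a *: (x * y) = x * (a *: y).
Proof.
apply/ffunP => U; rewrite !ffunE scaler_sumr; apply: eq_bigr => S _.
by rewrite ffunE /GRing.scale /= mulrCA.
Qed.

HB.instance Definition _ :=
  GRing.Lalgebra_isAlgebra.Build F G grassmann_scaleAr.

Definition grassmann_e S : G := [ffun T : {set 'I_m} => (T == S)%:R].

Lemma grassmann_eM S T : grassmann_e S * grassmann_e T =
  if [disjoint S & T] then (-1) ^+ inversions S T *: grassmann_e (S :|: T) else 0.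
Proof.
apply/ffunP => U; rewrite ffunE; have [sSU|nsSU] := boolP (S \subset U); last first.
  rewrite big1 => [|V sVU]; last first.
    by rewrite ffunE (_ : V == S = false) ?mulr0 ?mul0r //; apply: contraNF nsSU => /eqP<-.
  case: ifP => _; rewrite !ffunE // (_ : U == _ = false) ?scaler0 //.
  by apply: contraNF nsSU => /eqP->; apply: subsetUl.
rewrite (bigD1 S) //= big1 ?addr0 => [|V /andP[_ /negPf nVS]]; last first.
  by rewrite ffunE nVS mulr0 mul0r.
rewrite !ffunE eqxx mulr1.
have [<-|nUST] := eqVneq (U :\: S) T.
  rewrite disjoint_sym disjoints_subset subsetDr !ffunE.
  by rewrite setDE setUIr setUCr setIT (setUidPr sSU) eqxx.
rewrite mulr0; case: ifP => [dST|_]; rewrite !ffunE //.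
rewrite (_ : U == _ = false) ?scaler0 //; apply: contraNF nUST => /eqP->.
by rewrite setDUl setDv set0U; apply/eqP/setDidPl; rewrite disjoint_sym.
Qed.

Lemma grassmann_anticomm (i j : 'I_m) :
  grassmann_e [set i] * grassmann_e [set j]
  = - (grassmann_e [set j] * grassmann_e [set i]).
Proof.
rewrite !grassmann_eM !disjoints1 !inE (eq_sym j i).
have [|nij] := eqVneq i j; first by rewrite oppr0.
rewrite setUC -scaleNr; congr (_ *: _); rewrite /inversions !big_set1.
by case: ltngtP nij => [|| /val_inj ->] //=; rewrite ?eqxx // expr0 expr1 ?opprK.
Qed.

End Grassmann.

Definition G4 (F : fieldType) : subalg F :=
  @Subalg F (grassmann F 4) predT (conj isT (fun _ _ _ _ _ => isT)) (fun _ _ _ _ => isT).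

(* By convention below a multilinear polynomial of degree n is given by its   *)
(* coefficients on the monomials x_(s 0) x_(s 1) ... x_(s (n - 1)), s : 'S_n. *)
(* The action of t : 'S_n by x_i |-> x_(t i) maps the monomial of s to that   *)
(* of s * t (the product of perm.v is left-to-right), so that the S_n-module  *)
(* P_n is literally the regular representation of mxrepresentation.           *)
Notation Sn n := [set: 'S_n]%G.
Notation multilin F n := 'rV[F]_(gcard (Sn n)).
Notation P_repr F n := (regular_repr F (Sn n)).

Definition monom (F : fieldType) n (s : 'S_n) : multilin F n :=
  delta_mx 0 (gring_index (Sn n) s).

Section Subspace.

Variables (F : fieldType) (m : nat).

(* A matrix whose row space is the linear subspace P. *)
Definition subspace_mx (P : 'rV[F]_m -> Prop) : 'M[F]_m :=
  classical_sets.xget 0 (fun U : 'M[F]_m => forall v, (v <= U)%MS <-> P v).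

Lemma subspace_mxP (P : 'rV[F]_m -> Prop) :
    P 0 -> (forall a u v, P u -> P v -> P (a *: u + v)) ->
  forall v, (v <= subspace_mx P)%MS <-> P v.
Proof.
move=> P0 PL; apply: (@classical_sets.xgetPex _ _
  (fun U : 'M[F]_m => forall v, (v <= U)%MS <-> P v)).
pose Q r := `[< exists2 U : 'M[F]_m, \rank U = r & forall v, (v <= U)%MS -> P v >].
have Q0 : exists r, Q r.
  exists 0; apply/asboolP; exists 0; first exact: mxrank0.
  by move=> v; rewrite submx0 => /eqP->.
have Qm r : Q r -> (r <= m)%N by move=> /asboolP[U <- _]; apply: rank_leq_row.
case: (ex_maxnP Q0 Qm) => r /asboolP[U rU PU] maxU; exists U => v; split=> [/PU //|Pv].
have PUv w : (w <= (U + v)%MS)%MS -> P w.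
  case/sub_addsmxP => -[a b] /= ->; rewrite [b]mx11_scalar mul_scalar_mx addrC.
  by apply: PL => //; apply: PU; apply: submxMl.
have: (\rank (U + v)%MS <= \rank U)%N.
  by rewrite rU; apply: maxU; apply/asboolP; exists (U + v)%MS.
rewrite (geq_leqif (mxrank_leqif_sup (addsmxSl U v))) => sUvU.
exact: submx_trans (addsmxSr U v) sUvU.
Qed.

End Subspace.

Section Cocharacters.

Variables (F : fieldType) (A : subalg F) (n : nat).
Implicit Types (f : multilin F n) (a : 'I_n -> ambient A).

(* For n > 0 the value of f lies in A when all a i do. *)
Definition eval f a : ambient A :=
  \sum_(s : 'S_n) f 0 (gring_index (Sn n) s) *: \prod_(i < n) a (s i).

Definition is_identity f : Prop :=
  forall a, (forall i, a i \in elts A) -> eval f a = 0.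

Definition is_central f : Prop :=
  forall a, (forall i, a i \in elts A) -> in_center (eval f a).

Definition Id_mx : 'M[F]_(gcard (Sn n)) := subspace_mx is_identity.
Definition Idz_mx : 'M[F]_(gcard (Sn n)) := subspace_mx is_central.

Lemma evalL c f g a : eval (c *: f + g) a = c *: eval f a + eval g a.
Proof.
rewrite /eval scaler_sumr -big_split; apply: eq_bigr => s _ /=.
by rewrite !mxE scalerDl scalerA.
Qed.

Lemma eval0 a : eval 0 a = 0.
Proof. by rewrite /eval big1 // => s _; rewrite mxE scale0r. Qed.

Lemma in_center0 : in_center (0 : ambient A).
Proof. by split=> [|b _]; rewrite ?mul0r ?mulr0 //; case: (elts_submod A). Qed.

Lemma Id_mxP f : (f <= Id_mx)%MS <-> is_identity f.
Proof.
apply: subspace_mxP => [a _|c g h Ig Ih a Aa]; first exact: eval0.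
by rewrite evalL Ig // Ih // scaler0 addr0.
Qed.

Lemma Idz_mxP f : (f <= Idz_mx)%MS <-> is_central f.
Proof.
apply: subspace_mxP => [a _|c g h Ig Ih a Aa].
  by rewrite eval0; apply: in_center0.
rewrite evalL; case: (Ig a Aa) (Ih a Aa) => [Ag Zg] [Ah Zh]; split.
  by case: (elts_submod A) => _; apply.
by move=> b Ab; rewrite mulrDl mulrDr -scalerAl -scalerAr Zg // Zh.
Qed.

Lemma Id_Idz : (Id_mx <= Idz_mx)%MS.
Proof.
apply/rV_subP => f /Id_mxP If; apply/Idz_mxP => a Aa.
by rewrite If //; apply: in_center0.
Qed.

Lemma monom_act (s t : 'S_n) :
  monom F s *m P_repr F n t = monom F (s * t)%g.
Proof. by rewrite /monom -rowE rowK gring_indexK ?inE. Qed.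

Lemma eval_monom (s : 'S_n) a : eval (monom F s) a = \prod_(i < n) a (s i).
Proof.
rewrite /eval (bigD1 s) //= [X in _ + X]big1 => [|t nts].
  by rewrite mxE !eqxx scale1r addr0.
rewrite mxE eqxx /=; case: eqP => [e|_]; last exact: scale0r.
case/negP: nts; apply/eqP; rewrite -(@gring_indexK _ (Sn n) t) ?inE //.
by rewrite e gring_indexK ?inE.
Qed.

Lemma multilin_monom f :
  f = \sum_(s : 'S_n) f 0 (gring_index (Sn n) s) *: monom F s.
Proof.
rewrite {1}[f]row_sum_delta (reindex_onto (gring_index (Sn n)) enum_val) /=.
  by apply: eq_bigl => s; rewrite gring_indexK ?inE ?eqxx.
by move=> i _; apply: gring_valK.
Qed.

Lemma eval_sum (I : finType) (c : I -> F) (g : I -> multilin F n) a :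
  eval (\sum_i c i *: g i) a = \sum_i c i *: eval (g i) a.
Proof.
elim/big_rec2: _ => [|i x y _ <-]; first exact: eval0.
exact: evalL.
Qed.

Lemma eval_act f (t : 'S_n) a :
  eval (f *m P_repr F n t) a = eval f (fun i => a (t i)).
Proof.
rewrite {1}[f]multilin_monom mulmx_suml.
under eq_bigr do rewrite -scalemxAl monom_act.
rewrite eval_sum; apply: eq_bigr => s _; rewrite eval_monom.
by congr (_ *: _); apply: eq_bigr => i _; rewrite permM.
Qed.

Lemma Id_module : mxmodule (P_repr F n) Id_mx.
Proof.
apply/mxmoduleP => t _; apply/rV_subP => f /submxP[g ->{f}].
rewrite mulmxA; apply/Id_mxP => a Aa; rewrite eval_act.
by have /Id_mxP If := submxMl g Id_mx; apply: If.
Qed.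

Lemma Idz_module : mxmodule (P_repr F n) Idz_mx.
Proof.
apply/mxmoduleP => t _; apply/rV_subP => f /submxP[g ->{f}].
rewrite mulmxA; apply/Idz_mxP => a Aa; rewrite eval_act.
by have /Idz_mxP If := submxMl g Idz_mx; apply: If.
Qed.

Lemma Id_in_Idz_module :
  mxmodule (submod_repr Idz_module) <<in_submod Idz_mx Id_mx>>%MS.
Proof. by rewrite (eqmx_module _ (genmxE _)) in_submod_module ?Id_Idz ?Id_module. Qed.

Definition chi_z : {ffun 'S_n -> F} :=
  [ffun s => \tr (factmod_repr Idz_module s)].

Definition chi_delta : {ffun 'S_n -> F} :=
  [ffun s => \tr (factmod_repr Id_in_Idz_module s)].

End Cocharacters.

Arguments chi_z {F} A n.
Arguments chi_delta {F} A n.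

Section IrreducibleCharacters.

Variables (F : fieldType) (n : nat).

(* Zero parts are allowed at the end. *)
Definition is_part (la : seq nat) : bool := sorted geq la && (sumn la == n).

(* Partitions of n, padded with zeros to n parts. *)
Notation intpart := {la : n.-tuple 'I_n.+1 | is_part (map val la)}.

(* The Young tableau of shape la filled with 0, ..., n - 1 row after row has  *)
(* i in row reshape_index la i and column reshape_offset la i.                *)
Definition row_stab (la : seq nat) : {set 'S_n} :=
  [set s : 'S_n | [forall i, reshape_index la (s i) == reshape_index la i]].

Definition col_stab (la : seq nat) : {set 'S_n} :=
  [set s : 'S_n | [forall i, reshape_offset la (s i) == reshape_offset la i]].

(* t * s is the composite of functions s \o t. *)
Definition young_sym (la : seq nat) : multilin F n :=
  \sum_(s in row_stab la) \sum_(t in col_stab la)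
     (-1) ^+ t *: monom F (t * s)%g.

(* The character of the left ideal of F S_n generated by young_sym la.        *)
Definition irr_chi (la : seq nat) : {ffun 'S_n -> F} :=
  [ffun s => \tr (submod_repr
     (cyclic_mx_module (P_repr F n) (young_sym la)) s)].

(* The multiplicities m such that chi = \sum_la m la * irr_chi la. *)
Definition multiplicities (chi : {ffun 'S_n -> F}) : {ffun intpart -> nat} :=
  classical_sets.xget [ffun=> 0%N] (fun m : {ffun intpart -> nat} =>
    chi = \sum_(la : intpart) irr_chi (map val (val la)) *+ m la).

Definition colength (chi : {ffun 'S_n -> F}) : nat :=
  \sum_(la : intpart) multiplicities chi la.

End IrreducibleCharacters.

Arguments irr_chi F {n} la.

Definition l_z (F : fieldType) (A : subalg F) n : nat := colength (chi_z A n).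
Definition l_delta (F : fieldType) (A : subalg F) n : nat :=
  colength (chi_delta A n).

(* Main.v *)
Require Import Defs.
From HB Require Import structures.
From mathcomp Require Import all_boot all_order all_fingroup all_algebra.
From mathcomp Require Import mxrepresentation zify ring.
From mathcomp Require classical_sets.

(* Id(A1), which is also Id^z(A1), consists of the f whose coefficients sum to *)
(* 0 over the monomials with any given last letter (first letter for A1* ); in *)
(* particular the sum S of all coefficients of f is then 0. For k positions    *)
(* u_1, ..., u_k let phi_k(f)(u) be the sum of the coefficients of f, each     *)
(* multiplied by the sign of the order in which x_(u_1), ..., x_(u_k) occur in *)
(* its monomial; this is an alternating function of u. When S = 0, f is always *)
(* central on A2, it vanishes on A2 iff phi_2(f) = 0, it is central on G_4 iff *)
(* phi_3(f) = 0, and it vanishes on G_4 iff phi_2(f) = phi_4(f) = 0. Moreover  *)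
(* phi_3 = d phi_2 for the simplicial coboundary d. On Id(A1), phi_2 maps onto *)
(* all alternating functions Alt_2, and phi_4 maps Id(A1) /\ Ker(phi_2) onto   *)
(* Alt_4, so all the characters are those of Alt_k and d(Alt_k). The complex   *)
(* (Alt_k, d) is exact, and d(Alt_k) is isomorphic to the right ideal          *)
(* generated by the Young symmetrizer of the hook (n - k, 1^k). Finally the    *)
(* lengths are well defined because the irr_chi are linearly independent:      *)
(* \sum_t sgn(t) chi(t), for t in the column stabilizer of mu, vanishes at     *)
(* irr_chi la unless mu dominates la, and is nonzero at irr_chi mu.            *)

Set Implicit Arguments.
Unset Strict Implicit.
Unset Printing Implicit Defensive.

Import Order.TTheory GRing.Theory Num.Theory.
Local Open Scope ring_scope.

(** * Traces on invariant subspaces *)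

(** All the subspaces of P_n involved are common kernels of S_n-equivariant linear maps. Each
    character is therefore a difference of traces ([chi_zE], [chi_deltaE]), and traces add along
    kernel and image ([tr_on_ker_im]). Write H_k for the character of the hook (n - k, 1^k), and
    phi_k for [order_map k].

    Let B be [A1] or [A1s]. A product in B remembers only one of its factors, the last or the first,
    and up to scalars forgets the others; the center of B is zero. So identities and central
    polynomials of B form the same space K, the kernel of [marked_map], and P_n/K is the permutation
    module, with character H_0 + H_1.

    An element of K has coefficient sum zero. Hence on [A2] only substitutions with exactly two
    non-unit basis elements matter, and on [G4] only those with two, three or four odd ones; the
    values are then governed by the alternating functions phi_k(f). This describes the central
    polynomials and the identities of the sums: K and K /\ Ker(phi_2) for [A2], K /\ Ker(phi_3) and
    K /\ Ker(phi_2) /\ Ker(phi_4) for [G4] ([vsp_Idz_A2] to [vsp_Id_G4]).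

    The images are found by swapping letters in adjacent places of a monomial: phi_2 maps K onto
    Alt_2, phi_4 maps K /\ Ker(phi_2) onto Alt_4, and phi_3 = d phi_2 maps K onto d(Alt_2). As
    d(Alt_k) has character H_k ([irr_chi_hook]) and d is exact, Alt_k contributes H_(k-1) + H_k
    ([tr_on_Alt]). Subtraction gives H_0 + H_1 and H_1 + H_2 for [A2], H_0 + H_1 + H_2 and H_1 + H_3
    + H_4 for [G4]. By [irr_chi_indep] multiplicities are unique, so the lengths count these
    hooks. *)

Section TraceOn.

Variable F : fieldType.

(** The trace of the restriction of [f], meaningful when [U] is stable under [f]. With it,
    characters are computed inside fixed vector spaces, without sub- and quotient
    representations. *)
Definition tr_on (V : vectType F) (f : 'End(V)) (U : {vspace V}) : F :=
  \sum_(i < \dim U) coord (vbasis U) i (f (vbasis U)`_i).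

(** Expanding the images in one basis and the vectors of the other basis turns both traces into one
    double sum. *)
Lemma tr_on_basis (V : vectType F) (f : 'End(V)) (U : {vspace V}) m
    (X : m.-tuple V) :
    basis_of U X -> {in U, forall u, f u \in U} ->
  tr_on f U = \sum_(i < m) coord X i (f X`_i).
Proof.
move=> bX fU; have bY := vbasisP U; rewrite /tr_on; set Y := vbasis U in bY *.
have memX i : X`_i \in U.
  case: (ltnP i m) => him; last by rewrite nth_default ?mem0v ?size_tuple.
  by apply: (basis_mem bX); rewrite mem_nth ?size_tuple.
have memY i : Y`_i \in U.
  case: (ltnP i (\dim U)) => him; last by rewrite nth_default ?mem0v ?size_tuple.
  by apply: (basis_mem bY); rewrite mem_nth ?size_tuple.
transitivity (\sum_(i < \dim U) \sum_(j < m)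
    coord X j (f Y`_i) * coord Y i X`_j).
  apply: eq_bigr => i _; rewrite {1}(coord_basis bX (fU _ (memY i))) linear_sum.
  by apply: eq_bigr => j _; rewrite linearZ.
rewrite exchange_big; apply: eq_bigr => j _ /=.
rewrite {2}(coord_basis bY (memX j)) linear_sum linear_sum.
by apply: eq_bigr => i _; rewrite !linearZ /= mulrC.
Qed.

(** In a basis of [U] that extends one of the kernel part [K], the matrix of [f] is block
    triangular, and [phi] carries the complementary basis vectors to a basis of the image. *)
Lemma tr_on_ker_im (V W : vectType F) (phi : 'Hom(V, W)) (f : 'End(V))
    (g : 'End(W)) (U : {vspace V}) :
    {in U, forall u, f u \in U} -> {in U, forall u, phi (f u) = g (phi u)} ->
  tr_on f U = tr_on f (U :&: lker phi) + tr_on g (phi @: U).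
Proof.
move=> fU phif; set K := (U :&: lker phi)%VS; set L := (U :\: lker phi)%VS.
have fK : {in K, forall u, f u \in K}.
  move=> u; rewrite /K !memv_cap !memv_ker => /andP[uU /eqP pu0].
  by rewrite fU // phif // pu0 linear0 /=.
have bX := vbasisP K; have bY := vbasisP L.
set X := vbasis K in bX *; set Y := vbasis L in bY *.
have KL0 : (K :&: L = 0)%VS.
  apply/eqP; rewrite -subv0 -(capv_diff U (lker phi)) capvC capvS //.
  exact: capvSr.
have KLU : (K + L = U)%VS by rewrite addvC addv_diff_cap.
have bZ : basis_of U (X ++ Y).
  rewrite -KLU; apply: cat_basis => //; first by apply/directv_addP.
have Lker : (L :&: lker phi = 0)%VS by rewrite capv_diff.
have imL : (phi @: U = phi @: L)%VS.
  rewrite -KLU limgD; have -> : (phi @: K = 0)%VS.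
    by apply/eqP; rewrite -lkerE capvSr.
  by rewrite add0v.
have bpY : basis_of (phi @: U) (map_tuple phi Y).
  by rewrite imL; apply: limg_basis_of.
have gU : {in (phi @: U)%VS, forall u, g u \in (phi @: U)%VS}.
  move=> _ /memv_imgP[u uU ->]; rewrite -phif //.
  by apply: memv_img; apply: fU.
rewrite (tr_on_basis (X := cat_tuple X Y) bZ fU) (tr_on_basis bX fK) (tr_on_basis bpY gU).
rewrite big_split_ord /=; congr (_ + _); apply: eq_bigr => i _.
  rewrite nth_cat size_tuple ltn_ord.
  have XiK : X`_i \in K by apply: (basis_mem bX); rewrite mem_nth ?size_tuple.
  have := coord_basis bX (fK _ XiK) => /(congr1 (coord (cat_tuple X Y) (lshift _ i))).
  move=> ->; rewrite linear_sum (bigD1 i) //= big1 ?addr0 => [|j nji].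
    rewrite linearZ /=.
    have -> : X`_i = (cat_tuple X Y)`_(lshift (\dim L) i).
      by rewrite /= nth_cat size_tuple ltn_ord.
    by rewrite coord_free ?(basis_free bZ) // eqxx mulr1.
  rewrite linearZ /=.
  have -> : X`_j = (cat_tuple X Y)`_(lshift (\dim L) j).
    by rewrite /= nth_cat size_tuple ltn_ord.
  rewrite coord_free ?(basis_free bZ) //.
  by rewrite (inj_eq (@lshift_inj _ _)) (negPf nji) mulr0.
rewrite nth_cat size_tuple ltnNge leq_addr /= addKn.
have YiU : Y`_i \in U.
  apply: (subvP (diffvSl U (lker phi))).
  by apply: (basis_mem bY); rewrite mem_nth ?size_tuple.
rewrite (nth_map 0) ?size_tuple // -phif //.
rewrite [in RHS](coord_basis (X := cat_tuple X Y) bZ (fU _ YiU)).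
rewrite linear_sum linear_sum /= big_split_ord /=.
rewrite big1 ?add0r => [|j _]; last first.
  rewrite nth_cat size_tuple ltn_ord linearZ /=.
  have : X`_j \in K by apply: (basis_mem bX); rewrite mem_nth ?size_tuple.
  by rewrite memv_cap memv_ker => /andP[_ /eqP->]; rewrite scaler0 linear0.
have pY (j : 'I_(\dim L)) : phi Y`_j = (map_tuple phi Y)`_j.
  by rewrite (nth_map 0) ?size_tuple.
rewrite (bigD1 i) //= big1 ?addr0 => [|j nji].
  rewrite nth_cat size_tuple ltnNge leq_addr /= addKn linearZ linearZ /= pY.
  by rewrite coord_free ?(basis_free bpY) // eqxx mulr1.
rewrite nth_cat size_tuple ltnNge leq_addr /= addKn linearZ linearZ /= pY.
by rewrite coord_free ?(basis_free bpY) // (negPf nji) mulr0.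
Qed.

(** Both sides are the trace on the whole space minus the trace on the common kernel. This
    identifies a Young ideal with a space of alternating functions without an explicit
    isomorphism. *)
Lemma tr_on_eq_ker (V W W' : vectType F) (phi : 'Hom(V, W)) (psi : 'Hom(V, W'))
    (f : 'End(V)) (g : 'End(W)) (h : 'End(W')) :
    (forall u, phi (f u) = g (phi u)) -> (forall u, psi (f u) = h (psi u)) ->
    (lker phi = lker psi) ->
  tr_on g (limg phi) = tr_on h (limg psi).
Proof.
move=> pf qf kk; have fV : {in fullv, forall u, f u \in fullv}.
  by move=> u _; rewrite memvf.
have /eqP := tr_on_ker_im fV (in1W pf).
rewrite (tr_on_ker_im fV (in1W qf)) kk => /eqP.
by move/addrI.
Qed.

End TraceOn.

(** * Row spaces of matrices as subspaces *)

Section RowSpace.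

Variable F : fieldType.

Definition vsp m r (R : 'M[F]_(r, m)) : {vspace 'rV[F]_m} :=
  limg (linfun (mulmxr R : 'rV_r -> 'rV_m)).

Lemma mem_vsp m r (R : 'M[F]_(r, m)) v : (v \in vsp R) = (v <= R)%MS.
Proof.
apply/idP/submxP => [/memv_imgP[w _ ->]|[w ->]].
  by exists w; rewrite lfunE.
by apply/memv_imgP; exists w; rewrite ?memvf // lfunE.
Qed.

Lemma eq_vsp m r r' (R : 'M[F]_(r, m)) (R' : 'M[F]_(r', m)) :
  (R :=: R')%MS -> vsp R = vsp R'.
Proof. by move=> e; apply/vspaceP => v; rewrite !mem_vsp e. Qed.

Lemma tr_on_mxtrace m r (R : 'M[F]_(r, m)) (A : 'M_m) (B : 'M_r) :
  row_free R -> R *m A = B *m R -> tr_on (linfun (mulmxr A)) (vsp R) = \tr B.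
Proof.
move=> fR RA; pose X := [tuple row i R | i < r].
have XE (i : 'I_r) : X`_i = row i R by rewrite -tnth_nth tnth_mktuple.
have sumX (c : 'I_r -> F) : \sum_i c i *: X`_i = (\row_i c i) *m R.
  by rewrite mulmx_sum_row; apply: eq_bigr => i _; rewrite XE mxE.
have bX : basis_of (vsp R) X.
  apply/andP; split.
    rewrite eqEsubv; apply/andP; split.
      by apply/span_subvP => _ /mapP[i _ ->]; rewrite mem_vsp row_sub.
    apply/subvP => v; rewrite mem_vsp => /submxP[w ->].
    rewrite mulmx_sum_row rpred_sum // => i _; rewrite memvZ // -XE memv_span //.
    by rewrite mem_nth ?size_tuple.
  apply/freeP => c; rewrite sumX => /eqP; rewrite mulmx_free_eq0 // => /eqP c0 i.
  by have := congr1 (fun v : 'rV_r => v 0 i) c0; rewrite !mxE.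
rewrite (tr_on_basis bX) => [|v]; last first.
  rewrite !mem_vsp lfunE /= => /submxP[w ->].
  by rewrite -mulmxA RA mulmxA submxMl.
apply: eq_bigr => i _; rewrite lfunE /= XE -row_mul RA row_mul mulmx_sum_row.
have -> : \sum_j row i B 0 j *: row j R = \sum_j B i j *: X`_j.
  by apply: eq_bigr => j _; rewrite XE mxE.
by rewrite coord_sum_free ?(basis_free bX).
Qed.

End RowSpace.

(** * The regular module and its characters as traces *)

Section GroupAlgebra.

Variables (F : fieldType) (n : nat).
Implicit Types (f : multilin F n) (s t : 'S_n).

Definition cf f s : F := f 0 (gring_index (Sn n) s).

Definition rho s : 'End(multilin F n) := linfun (mulmxr (P_repr F n s)).

Lemma rhoE s f : rho s f = f *m P_repr F n s.
Proof. by rewrite lfunE. Qed.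

Lemma cf_monom s t : cf (monom F s) t = (t == s)%:R.
Proof.
by rewrite /cf /monom mxE eqxx /= (can_in_eq (@gring_indexK _ _)) ?inE.
Qed.

Lemma cf_sum (I : Type) (r : seq I) (P : pred I) (g : I -> multilin F n) s :
  cf (\sum_(i <- r | P i) g i) s = \sum_(i <- r | P i) cf (g i) s.
Proof. by rewrite /cf summxE. Qed.

Lemma cfZ a f s : cf (a *: f) s = a * cf f s.
Proof. by rewrite /cf mxE. Qed.

Lemma multilinP f f' : cf f =1 cf f' -> f = f'.
Proof.
by move=> e; apply/rowP => i; have := e (enum_val i); rewrite /cf gring_valK.
Qed.

Lemma monomE f : f = \sum_s cf f s *: monom F s.
Proof. exact: multilin_monom. Qed.

Lemma rho_monom s t : rho t (monom F s) = monom F (s * t)%g.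
Proof. by rewrite rhoE monom_act. Qed.

Lemma cf_rho f t s : cf (rho t f) s = cf f (s * t^-1)%g.
Proof.
rewrite {1}[f]monomE linear_sum cf_sum (bigD1 (s * t^-1)%g) //= big1 => [|r nr].
  by rewrite linearZ /= rho_monom cfZ cf_monom mulgKV eqxx mulr1 addr0.
rewrite linearZ /= rho_monom cfZ cf_monom.
by rewrite -(can2_eq (mulgKV t) (mulgK t)) eq_sym (negPf nr) mulr0.
Qed.

Section Extend.

Variables (W : vectType F) (G : 'S_n -> W).

Definition extend_fun f : W := \sum_s cf f s *: G s.

Fact extend_fun_linear : linear extend_fun.
Proof.
move=> a f g; rewrite /extend_fun scaler_sumr -big_split; apply: eq_bigr => s _.
by rewrite /cf !mxE scalerDl scalerA.
Qed.
HB.instance Definition _ :=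
  GRing.isLinear.Build F (multilin F n) W *:%R extend_fun extend_fun_linear.

Definition extend : 'Hom(multilin F n, W) := linfun extend_fun.

Lemma extendE f : extend f = \sum_s cf f s *: G s.
Proof. by rewrite lfunE. Qed.

Lemma extend_monom s : extend (monom F s) = G s.
Proof.
rewrite extendE (bigD1 s) //= big1 ?addr0 ?cf_monom ?eqxx ?scale1r // => t nt.
by rewrite cf_monom (negPf nt) scale0r.
Qed.

Lemma extend_equiv (act : 'End(W)) t f :
  (forall s, G (s * t)%g = act (G s)) -> extend (rho t f) = act (extend f).
Proof.
move=> Gt; rewrite {1 2}[f]monomE !linear_sum; apply: eq_bigr => s _.
by rewrite !linearZ /= rho_monom !extend_monom Gt.
Qed.

End Extend.

Lemma eval_extend (A : subalg F) (a : 'I_n -> ambient A) f :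
  eval f a = \sum_s cf f s *: \prod_(i < n) a (s i).
Proof. by []. Qed.

Lemma tr_on_submod (U : 'M[F]_(gcard (Sn n))) (modU : mxmodule (P_repr F n) U) s :
  \tr (submod_repr modU s) = tr_on (rho s) (vsp U).
Proof.
have <- : vsp (val_submod (1%:M : 'M_(\rank U))) = vsp U.
  exact/eq_vsp/val_submod1.
rewrite (tr_on_mxtrace (B := submod_repr modU s)) //.
  by rewrite -row_leq_rank val_submod1.
by rewrite -val_submodJ ?inE // mul1mx val_submodE.
Qed.

Lemma tr_on_fullv s : \tr (P_repr F n s) = tr_on (rho s) fullv.
Proof.
have -> : fullv = vsp (1%:M : 'M[F]_(gcard (Sn n))).
  by apply/vspaceP => v; rewrite memvf mem_vsp submx1.
rewrite (tr_on_mxtrace (B := P_repr F n s)) ?mul1mx ?mulmx1 //.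
by rewrite -row_leq_rank mxrank1.
Qed.

Lemma chi_zE (A : subalg F) s :
  chi_z A n s = tr_on (rho s) fullv - tr_on (rho s) (vsp (Idz_mx A n)).
Proof.
rewrite ffunE -tr_on_fullv -(tr_on_submod (Idz_module A n)).
by rewrite -(mxtrace_sub_fact_mod (Idz_module A n)) addrC addKr.
Qed.

Lemma chi_deltaE (A : subalg F) s :
  chi_delta A n s = tr_on (rho s) (vsp (Idz_mx A n)) - tr_on (rho s) (vsp (Id_mx A n)).
Proof.
rewrite ffunE -(tr_on_submod (Idz_module A n)) -(tr_on_submod (Id_module A n)).
rewrite -(mxtrace_sub_fact_mod (Id_in_Idz_module A n)).
have [modW simW] := mx_rsim_in_submod (Id_module A n) (Idz_module A n) (Id_Idz A n).
rewrite (mxtrace_rsim simW) ?inE //.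
by rewrite (bool_irrelevance modW (Id_in_Idz_module A n)) addrC addKr.
Qed.

(** The cyclic module generated by the Young symmetrizer is the image of the map that multiplies the
    symmetrizer by a variable element of the group algebra. *)
Lemma irr_chiE (la : seq nat) s :
  irr_chi F la s
  = tr_on (rho s) (limg (extend (fun t => rho t (young_sym F n la)))).
Proof.
rewrite ffunE tr_on_submod; congr (tr_on _ _); apply/vspaceP => v.
rewrite mem_vsp; apply/cyclic_mxP/memv_imgP => [[A /envelop_mxP[a ->] ->]|[f _ ->]].
  exists (\sum_t a t *: monom F t); first exact: memvf.
  rewrite mulmx_sumr linear_sum; apply: eq_big => t; rewrite ?inE // => _.
  by rewrite -scalemxAr linearZ /= extend_monom rhoE.
exists (\sum_t cf f t *: P_repr F n t).
  by apply/envelop_mxP; exists (cf f); apply: eq_bigl => t; rewrite inE.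
rewrite extendE mulmx_sumr; apply: eq_bigr => t _.
by rewrite rhoE -scalemxAr.
Qed.

End GroupAlgebra.

(** * Alternating functions and the coboundary *)

Lemma natf_eq0 (F : fieldType) : [pchar F] =i pred0 ->
  forall m, (m%:R == 0 :> F) = (m == 0)%N.
Proof. by move=> charF m; have /pcharf0P-> := charF. Qed.

Section AlternatingFunctions.

Variables (F : fieldType) (n : nat).
Hypothesis charF : [pchar F] =i pred0.

(* The k-th tensor power of the permutation module F^n, as functions on        *)
(* k-tuples of indices.                                                        *)
Definition tens k := {ffun {ffun 'I_k -> 'I_n} -> F^o}.
HB.instance Definition _ k := GRing.Zmodule.on (tens k).
HB.instance Definition _ k := Vector.on (tens k).

Definition fcomp j k (u : {ffun 'I_k -> 'I_n}) (h : 'I_j -> 'I_k) :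
  {ffun 'I_j -> 'I_n} := [ffun i => u (h i)].

Definition fmap k (s : 'S_n) (u : {ffun 'I_k -> 'I_n}) : {ffun 'I_k -> 'I_n} :=
  [ffun i => s (u i)].

Lemma fcompA i j k (u : {ffun 'I_k -> 'I_n}) (h : 'I_j -> 'I_k) (g : 'I_i -> 'I_j) :
  fcomp (fcomp u h) g = fcomp u (h \o g).
Proof. by apply/ffunP => x; rewrite !ffunE. Qed.

Lemma fmap_comp j k s (u : {ffun 'I_k -> 'I_n}) (h : 'I_j -> 'I_k) :
  fmap s (fcomp u h) = fcomp (fmap s u) h.
Proof. by apply/ffunP => x; rewrite !ffunE. Qed.

Section Act.

Variables (k : nat) (s : 'S_n).

Definition act_fun (w : tens k) : tens k := [ffun u => w (fmap s^-1 u)].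

Fact act_fun_linear : linear act_fun.
Proof. by move=> a v w; apply/ffunP => u; rewrite !ffunE. Qed.
HB.instance Definition _ :=
  GRing.isLinear.Build F (tens k) (tens k) *:%R act_fun act_fun_linear.

Definition act : 'End(tens k) := linfun act_fun.

Lemma actE w u : act w u = w (fmap s^-1 u).
Proof. by rewrite lfunE ffunE. Qed.

End Act.

Section Asym.

Variables (k : nat).

Definition asym_fun (w : tens k) : tens k :=
  [ffun u => \sum_(t : 'S_k) (-1) ^+ t * w (fcomp u t)].

Fact asym_fun_linear : linear asym_fun.
Proof.
move=> a v w; apply/ffunP => u; rewrite !ffunE scaler_sumr -big_split.
apply: eq_bigr => t _; rewrite !ffunE mulrDr; congr (_ + _).
by rewrite /GRing.scale /= mulrCA.
Qed.
HB.instance Definition _ :=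
  GRing.isLinear.Build F (tens k) (tens k) *:%R asym_fun asym_fun_linear.

Definition asym : 'End(tens k) := linfun asym_fun.

Lemma asymE w u : asym w u = \sum_(t : 'S_k) (-1) ^+ t * w (fcomp u t).
Proof. by rewrite lfunE ffunE. Qed.

(* Up to a scalar, the exterior product with the invariant vector of F^n.      *)
Definition dif_fun (w : tens k) : tens k.+1 :=
  [ffun u => \sum_(i < k.+1) (-1) ^+ i * w (fcomp u (lift i))].

Fact dif_fun_linear : linear dif_fun.
Proof.
move=> a v w; apply/ffunP => u; rewrite !ffunE scaler_sumr -big_split.
apply: eq_bigr => t _; rewrite !ffunE mulrDr; congr (_ + _).
by rewrite /GRing.scale /= mulrCA.
Qed.
HB.instance Definition _ :=
  GRing.isLinear.Build F (tens k) (tens k.+1) *:%R dif_fun dif_fun_linear.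

Definition dif : 'Hom(tens k, tens k.+1) := linfun dif_fun.

Lemma difE w u : dif w u = \sum_(i < k.+1) (-1) ^+ i * w (fcomp u (lift i)).
Proof. by rewrite lfunE ffunE. Qed.

Definition pullback (w : tens k) : tens k.+1 :=
  [ffun u => w (fcomp u (lift ord0))].

Definition is_alt (w : tens k) := forall u (t : 'S_k), w (fcomp u t) = (-1) ^+ t * w u.

Lemma asym_is_alt w : is_alt (asym w).
Proof.
move=> u t; rewrite !asymE mulr_sumr.
rewrite [RHS](reindex_inj (mulIg t)) /=; apply: eq_bigr => r _.
rewrite odd_permM signr_addb [_ * (-1) ^+ t]mulrC -mulrA signrMK fcompA.
by congr (_ * w _); apply/ffunP => i; rewrite !ffunE /= permM.
Qed.

Lemma asym_alt w : is_alt w -> asym w = k`!%:R *: w.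
Proof.
move=> alt_w; apply/ffunP => u; rewrite asymE !ffunE.
rewrite (eq_bigr (fun _ => w u)) => [|t _]; last by rewrite alt_w mulrA -expr2 sqrr_sign mul1r.
by rewrite sumr_const card_Sn /GRing.scale /= mulr_natl.
Qed.

Definition Alt : {vspace tens k} := limg asym.

Lemma AltP w : reflect (is_alt w) (w \in Alt).
Proof.
have k0 : (k`!%:R : F) != 0 by rewrite (natf_eq0 charF) // -lt0n fact_gt0.
apply: (iffP memv_imgP) => [[v _ ->]|alt_w]; first exact: asym_is_alt.
exists (k`!%:R^-1 *: w); rewrite ?memvf // linearZ /= asym_alt //.
by rewrite scalerA mulVf ?scale1r.
Qed.

Lemma alt_eq0 w (u : {ffun 'I_k -> 'I_n}) : is_alt w -> ~~ injectiveb u -> w u = 0.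
Proof.
move=> alt_w /injectivePn[i [j nij uij]]; have := alt_w u (tperm i j).
have -> : fcomp u (tperm i j) = u.
  by apply/ffunP => x; rewrite ffunE; case: tpermP => [->|->|].
rewrite odd_tperm nij mulN1r => /eqP; rewrite -addr_eq0 -mulr2n -mulr_natl.
by rewrite mulf_eq0 (natf_eq0 charF) //= => /eqP.
Qed.

Lemma asym_act s w : asym (act k s w) = act k s (asym w).
Proof.
by apply/ffunP => u; rewrite actE !asymE; apply: eq_bigr => t _; rewrite actE fmap_comp.
Qed.

End Asym.

Lemma dif_act k s w : dif k (act k s w) = act k.+1 s (dif k w).
Proof.
by apply/ffunP => u; rewrite actE !difE; apply: eq_bigr => t _; rewrite actE fmap_comp.
Qed.

(* Expansion of the antisymmetrization along the image of the first point. *)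
Lemma dif_asym k w : dif k (asym k w) = asym k.+1 (pullback w).
Proof.
apply/ffunP => u; rewrite difE asymE.
rewrite [RHS](partition_big (fun t : 'S_k.+1 => t ord0) xpredT) //=.
apply: eq_bigr => i _; rewrite asymE mulr_sumr.
rewrite [RHS](reindex (lift_perm ord0 i)); last first.
  (* [g t] is the permutation that [t] induces once [ord0] and its image are removed; the default is
     never taken, since [t] is injective. *)
  pose g (t : 'S_k.+1) x := odflt x (unlift (t ord0) (t (lift ord0 x))).
  have gK (t : 'S_k.+1) x : lift (t ord0) (g t x) = t (lift ord0 x).
    rewrite /g; case: unliftP => [y -> //|/perm_inj/eqP].
    by rewrite eq_sym (negPf (neq_lift _ _)).
  have injg t : injective (g t).
    move=> x y /(congr1 (lift (t ord0))); rewrite !gK.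
    by move/perm_inj/lift_inj.
  exists (fun t => perm (injg t)) => [r _|t].
    apply/permP => x; rewrite permE; apply: (@lift_inj _ i).
    by have := gK (lift_perm ord0 i r) x; rewrite lift_perm_lift lift_perm_id.
  rewrite inE => /eqP ti; apply/permP => x.
  case: (unliftP ord0 x) => [y|] ->; last by rewrite lift_perm_id.
  by rewrite lift_perm_lift permE -ti gK.
rewrite (eq_bigl xpredT) => [|t]; last by rewrite lift_perm_id eqxx.
apply: eq_bigr => t _; rewrite odd_lift_perm signr_addb mulrA ffunE !fcompA.
rewrite addFb signr_odd; congr (_ * w _).
by apply/ffunP => x; rewrite !ffunE /= lift_perm_lift.
Qed.

Lemma dif_alt k w : w \in Alt k -> dif k w \in Alt k.+1.
Proof.
case/memv_imgP => v _ ->; rewrite dif_asym; apply/memv_imgP.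
by exists (pullback v); rewrite ?memvf.
Qed.

(** By [dif_asym] the left side antisymmetrizes a function that ignores its first two arguments;
    exchanging these shows that every value is its own opposite. *)
Lemma dif_dif k w : w \in Alt k -> dif k.+1 (dif k w) = 0.
Proof.
case/memv_imgP => v _ ->; rewrite !dif_asym; apply/ffunP => u; rewrite ffunE asymE.
set S := \sum_t _; have : S = - S.
  rewrite {1}/S (reindex_inj (mulgI (tperm ord0 (lift ord0 ord0)))) -sumrN.
  apply: eq_bigr => t _; rewrite odd_permM odd_tperm signr_addb mulN1r mulNr.
  congr (- (_ * _)); rewrite !ffunE; congr (v _); apply/ffunP => x.
  by rewrite !ffunE permM tpermD // -?val_eqE.
move/eqP; rewrite -addr_eq0 -mulr2n -mulr_natl mulf_eq0 (natf_eq0 charF) //=.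
by move/eqP.
Qed.

Definition fcons k p (u : {ffun 'I_k -> 'I_n}) : {ffun 'I_k.+1 -> 'I_n} :=
  [ffun i => oapp u p (unlift ord0 i)].

Definition contract k p (w : tens k.+1) : tens k := [ffun u => w (fcons p u)].

Lemma contract_alt k p w : w \in Alt k.+1 -> contract p w \in Alt k.
Proof.
move/AltP => alt_w; apply/AltP => u t; rewrite !ffunE.
have -> : fcons p (fcomp u t) = fcomp (fcons p u) (lift_perm ord0 ord0 t).
  apply/ffunP => x; rewrite !ffunE; case: (unliftP ord0 x) => [y|] -> /=.
    by rewrite lift_perm_lift ffunE liftK.
  by rewrite lift_perm_id unlift_none.
by rewrite alt_w odd_lift_perm.
Qed.

(** Insertion of a fixed [p] as first argument is a contracting homotopy for [dif]; this is what
    makes the complex exact as soon as there is a point [p]. *)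
Lemma contract_dif k p w : contract p (dif k.+1 w) = w - dif k (contract p w).
Proof.
apply/ffunP => u; rewrite !ffunE !difE big_ord_recl /= expr0 mul1r.
congr (w _ + _).
  by apply/ffunP => x; rewrite !ffunE liftK.
rewrite -sumrN; apply: eq_bigr => i _; rewrite !ffunE exprS mulN1r mulNr.
congr (- (_ * w _)); apply/ffunP => x; rewrite !ffunE.
case: (unliftP ord0 x) => [y|] -> /=.
  have -> : lift (lift ord0 i) (lift ord0 y) = lift ord0 (lift i y).
    by apply: val_inj; rewrite /= /bump !leq0n !add1n ltnS addnS.
  by rewrite liftK /= ffunE.
have -> : lift (lift ord0 i) ord0 = ord0 by apply: val_inj.
by rewrite unlift_none.
Qed.

Lemma Alt_ker_dif k : (0 < n)%N -> (Alt k.+1 :&: lker (dif k.+1) = dif k @: Alt k)%VS.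
Proof.
move=> n0; apply/vspaceP => w; rewrite memv_cap memv_ker.
apply/andP/memv_imgP => [[aw /eqP dw]|[v av ->]]; last first.
  by rewrite dif_alt // dif_dif.
exists (contract (Ordinal n0) w); first exact: contract_alt.
have := contract_dif (Ordinal n0) w; rewrite dw => e.
apply/eqP; rewrite -subr_eq0 -e; apply/eqP.
by apply/ffunP => u; rewrite !ffunE.
Qed.

Lemma act_Alt k s w : w \in Alt k -> act k s w \in Alt k.
Proof.
case/memv_imgP => v _ ->; rewrite -asym_act.
by apply/memv_imgP; exists (act k s v); rewrite ?memvf.
Qed.

Lemma tr_on_AltS k s : (0 < n)%N ->
  tr_on (act k.+1 s) (Alt k.+1)
  = tr_on (act k.+1 s) (dif k @: Alt k) + tr_on (act k.+2 s) (dif k.+1 @: Alt k.+1).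
Proof.
move=> n0; rewrite -Alt_ker_dif //; apply: tr_on_ker_im => w Aw.
  exact: act_Alt.
exact: dif_act.
Qed.

End AlternatingFunctions.

(** * Hook characters *)

Section ExtendPermutation.

Variables (k n : nat) (pos : 'I_k -> 'I_n).
Hypothesis pos_inj : injective pos.

Definition ext_perm_fun (t : 'S_k) (x : 'I_n) : 'I_n :=
  if [pick j | pos j == x] is Some j then pos (t j) else x.

Lemma ext_perm_fun_pos t j : ext_perm_fun t (pos j) = pos (t j).
Proof.
rewrite /ext_perm_fun; case: pickP => [i /eqP/pos_inj-> //|/(_ j)].
by rewrite eqxx.
Qed.

Lemma ext_perm_fun_out t x : x \notin codom pos -> ext_perm_fun t x = x.
Proof.
rewrite /ext_perm_fun; case: pickP => // j /eqP <-.
by rewrite codom_f.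
Qed.

Lemma ext_perm_funM s t x :
  ext_perm_fun (s * t)%g x = ext_perm_fun t (ext_perm_fun s x).
Proof.
have [/codomP[j ->]|out] := boolP (x \in codom pos).
  by rewrite !ext_perm_fun_pos permM.
by rewrite !ext_perm_fun_out.
Qed.

Lemma ext_perm_inj t : injective (ext_perm_fun t).
Proof.
apply: (can_inj (g := ext_perm_fun t^-1)) => x; rewrite -ext_perm_funM mulgV.
have [/codomP[j ->]|out] := boolP (x \in codom pos).
  by rewrite ext_perm_fun_pos perm1.
by rewrite ext_perm_fun_out.
Qed.

Definition ext_perm t : 'S_n := perm (@ext_perm_inj t).

Lemma ext_perm_pos t j : ext_perm t (pos j) = pos (t j).
Proof. by rewrite permE ext_perm_fun_pos. Qed.

Lemma ext_perm_out t x : x \notin codom pos -> ext_perm t x = x.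
Proof. by move=> out; rewrite permE ext_perm_fun_out. Qed.

Lemma ext_permM s t : ext_perm (s * t) = (ext_perm s * ext_perm t)%g.
Proof. by apply/permP => x; rewrite permM !permE ext_perm_funM. Qed.

Lemma ext_perm1 : ext_perm 1 = 1%g.
Proof. by apply: (mulIg (ext_perm 1)); rewrite -ext_permM !mul1g. Qed.

Lemma ext_permV t : ext_perm t^-1 = (ext_perm t)^-1%g.
Proof. by apply: (mulIg (ext_perm t)); rewrite -ext_permM !mulVg ext_perm1. Qed.

Lemma ext_tperm i j : ext_perm (tperm i j) = tperm (pos i) (pos j).
Proof.
apply/permP => x; have [/codomP[l ->]|out] := boolP (x \in codom pos).
  by rewrite ext_perm_pos inj_tperm.
rewrite ext_perm_out // tpermD //; apply: contraNneq out => <-; exact: codom_f.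
Qed.

Lemma odd_ext_perm t : odd_perm (ext_perm t) = odd_perm t.
Proof.
have [ts -> _] := prod_tpermP t; elim: ts => [|[i j] ts IH] /=.
  by rewrite !big_nil ext_perm1 !odd_perm1.
rewrite !big_cons ext_permM !odd_permM IH ext_tperm /= !odd_tperm.
by rewrite (inj_eq pos_inj).
Qed.

Lemma ext_permP (q : 'S_n) :
  (forall x, x \notin codom pos -> q x = x) -> {t | q = ext_perm t}.
Proof.
move=> qout; have qin j : q (pos j) \in codom pos.
  apply/negPn/negP => out; have /perm_inj e := qout _ out.
  by rewrite e codom_f in out.
pose g j := iinv (qin j); have gE j : pos (g j) = q (pos j) by apply: f_iinv.
have g_inj : injective g.
  by move=> i j /(congr1 pos); rewrite !gE => /perm_inj/pos_inj.
exists (perm g_inj); apply/permP => x.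
have [/codomP[j ->]|out] := boolP (x \in codom pos).
  by rewrite ext_perm_pos permE gE.
by rewrite ext_perm_out // qout.
Qed.

End ExtendPermutation.

(** The values are corrected one at a time by a transposition, which by injectivity leaves the
    earlier ones in place. *)
Lemma perm_extends_inj k n (u v : 'I_k -> 'I_n) :
  injective u -> injective v -> exists s : 'S_n, forall i, s (u i) = v i.
Proof.
move=> iu iv; have H m : (m <= k)%N -> exists s : 'S_n, forall i : 'I_k, (i < m)%N -> s (u i) = v i.
  elim: m => [|m IH] le_mk; first by exists 1%g.
  have [s sP] := IH (ltnW le_mk); pose m' := Ordinal le_mk.
  exists (s * tperm (s (u m')) (v m'))%g => i; rewrite ltnS leq_eqVlt.
  case/predU1P => [im|lt_im].
    have -> : i = m' by apply: val_inj.
    by rewrite permM tpermL.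
  have nim : i != m' by rewrite -val_eqE /= neq_ltn lt_im.
  rewrite permM (sP i) // tpermD //.
    by rewrite -(sP i) // (inj_eq perm_inj) (inj_eq iu) eq_sym.
  by rewrite (inj_eq iv) eq_sym.
by have [s sP] := H k (leqnn k); exists s => i; apply: sP.
Qed.

(** * Words read off at given places, and Young symmetrizers of hooks *)

Section Places.

Variables (F : fieldType) (n : nat).
Hypothesis charF : [pchar F] =i pred0.

Definition word k (pos : 'I_k -> 'I_n) (s : 'S_n) : {ffun 'I_k -> 'I_n} :=
  [ffun i => s (pos i)].

Lemma wordM k (pos : 'I_k -> 'I_n) s t : word pos (s * t)%g = fmap t (word pos s).
Proof. by apply/ffunP => i; rewrite !ffunE permM. Qed.

Lemma word_inj k (pos : 'I_k -> 'I_n) s : injective pos -> injectiveb (word pos s).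
Proof.
by move=> ip; apply/injectiveP => i j; rewrite !ffunE => /perm_inj/ip.
Qed.

Lemma word_surj k (pos : 'I_k -> 'I_n) (u : {ffun 'I_k -> 'I_n}) :
  injective pos -> injectiveb u -> exists s, word pos s = u.
Proof.
move=> ip /injectiveP iu; have [s sP] := perm_extends_inj ip iu.
by exists s; apply/ffunP => i; rewrite ffunE.
Qed.

Lemma eq_fmap k (s : 'S_n) (u v : {ffun 'I_k -> 'I_n}) :
  (u == fmap s v) = (fmap s^-1 u == v).
Proof.
apply/eqP/eqP => [->|<-]; apply/ffunP => i; rewrite !ffunE ?permK //.
by rewrite permKV.
Qed.

Definition place k (pos : 'I_k -> 'I_n) (s : 'S_n) : tens F n k :=
  [ffun u => (u == word pos s)%:R].

Lemma placeM k (pos : 'I_k -> 'I_n) s t : place pos (s * t)%g = act F k t (place pos s).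
Proof. by apply/ffunP => u; rewrite actE !ffunE wordM eq_fmap. Qed.

Lemma place_equiv k (pos : 'I_k -> 'I_n) s f :
  extend (place pos) (rho F s f) = act F k s (extend (place pos) f).
Proof. by apply: extend_equiv => t; apply: placeM. Qed.

(** An alternating function vanishes on tuples with a repetition, and every other tuple is the word
    of some permutation. So it is already a combination of [place] functions, and [asym] only
    multiplies it by k!. *)
Lemma limg_asym_place k (pos : 'I_k -> 'I_n) : injective pos ->
  limg (asym F n k \o extend (place pos))%VF = Alt F n k.
Proof.
move=> ip; apply/vspaceP => w; apply/memv_imgP/idP => [[f _ ->]|aw].
  by rewrite lfunE /=; apply/memv_imgP; exists (extend (place pos) f); rewrite ?memvf.
have /(AltP charF) alt_w := aw.
pose f := \sum_(u : {ffun 'I_k -> 'I_n} | injectiveb u)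
  w u *: monom F (odflt 1%g [pick s | word pos s == u]).
have fE : extend (place pos) f = w.
  rewrite /f linear_sum; apply/ffunP => v.
  rewrite sum_ffunE.
  have wordP (u : {ffun 'I_k -> 'I_n}) : injectiveb u ->
      word pos (odflt 1%g [pick s | word pos s == u]) = u.
    move=> iu; case: pickP => [s /eqP //|no]; have [s su] := word_surj ip iu.
    by have := no s; rewrite su eqxx.
  have [iv|niv] := boolP (injectiveb v); last first.
    rewrite (alt_eq0 charF alt_w niv) big1 // => u iu.
    rewrite linearZ /= extend_monom !ffunE wordP //.
    have -> : v == u = false by apply: contraNF niv => /eqP->.
    by rewrite scaler0.
  rewrite (bigD1 v) //= big1 ?addr0 => [|u /andP[iu nuv]].
    by rewrite linearZ /= extend_monom !ffunE wordP // eqxx /GRing.scale /= mulr1.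
  rewrite linearZ /= extend_monom !ffunE wordP //.
  by rewrite eq_sym (negPf nuv) scaler0.
exists (k`!%:R^-1 *: f); rewrite ?memvf // comp_lfunE !linearZ /= fE (asym_alt alt_w).
by rewrite scalerA mulVf ?scale1r // (natf_eq0 charF) -lt0n fact_gt0.
Qed.

Section Hook.

Variable k : nat.
Hypothesis lt_kn : (k < n)%N.

Definition first_pos : 'I_n := Ordinal (leq_ltn_trans (leq0n k) lt_kn).

Fact last_pos_proof (i : 'I_k) : (n - k + i < n)%N.
Proof. by rewrite -[ltnRHS](subnK (ltnW lt_kn)) ltn_add2l. Qed.

Definition last_pos (i : 'I_k) : 'I_n := Ordinal (last_pos_proof i).

(** The entries of the first column of the row-by-row tableau of the hook, from top to bottom. *)
Definition hook_pos (j : 'I_k.+1) : 'I_n :=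
  if unlift ord0 j is Some i then last_pos i else first_pos.

Lemma hook_pos0 : hook_pos ord0 = first_pos.
Proof. by rewrite /hook_pos unlift_none. Qed.

Lemma hook_posS i : hook_pos (lift ord0 i) = last_pos i.
Proof. by rewrite /hook_pos liftK. Qed.

Lemma last_pos_inj : injective last_pos.
Proof. by move=> i j /(congr1 val)/= /addnI/val_inj. Qed.

Lemma low_last (x : 'I_n) : ~~ (x < n - k)%N -> exists i, x = last_pos i.
Proof.
rewrite -leqNgt => le_x; have lt_i : (x - (n - k) < k)%N.
  by rewrite ltn_subLR // subnK ?(ltnW lt_kn).
by exists (Ordinal lt_i); apply: val_inj; rewrite /= subnKC.
Qed.

Lemma last_posF i : (last_pos i < n - k)%N = false.
Proof. by rewrite ltnNge leq_addr. Qed.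

Lemma hook_pos_inj : injective hook_pos.
Proof.
move=> x y; case: (unliftP ord0 x) => [i|] ->; case: (unliftP ord0 y) => [j|] ->;
  rewrite ?hook_pos0 ?hook_posS //.
- by move/last_pos_inj->.
- by move/(congr1 (fun z : 'I_n => z < n - k)%N); rewrite last_posF /= subn_gt0 lt_kn.
- by move/(congr1 (fun z : 'I_n => z < n - k)%N); rewrite last_posF /= subn_gt0 lt_kn.
Qed.

Lemma codom_hook_pos x : (x \in codom hook_pos) = ~~ (0 < x < n - k)%N.
Proof.
apply/codomP/idP => [[j ->]|].
  case: (unliftP ord0 j) => [i|] ->; rewrite ?hook_pos0 ?hook_posS //.
  by rewrite last_posF andbF.
rewrite negb_and -leqNgt leqn0 => /orP[/eqP x0|/low_last[i ->]]; last first.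
  by exists (lift ord0 i); rewrite hook_posS.
by exists ord0; rewrite hook_pos0; apply: val_inj.
Qed.

(** Only the cells of the shape are prescribed, so that the hook may carry any number of trailing
    zeros. *)
Variable la : seq nat.
Hypothesis indexE : forall i, (i < n)%N ->
  reshape_index la i = if (i < n - k)%N then 0%N else (i - (n - k)).+1.
Hypothesis offsetE : forall i, (i < n)%N ->
  reshape_offset la i = if (i < n - k)%N then i else 0%N.

Lemma hook_row_stab s : (s \in row_stab n la) = [forall i, s (last_pos i) == last_pos i].
Proof.
rewrite inE; apply/forallP/forallP => [sP i|sP x].
  have := sP (last_pos i); rewrite !indexE ?ltn_ord // last_posF.
  case: ifP => // /negbT/low_last[j ->].
  by rewrite /= !addKn eqSS => /eqP/val_inj->.
have [lx|/low_last[i ->]] := boolP (x < n - k)%N; last by rewrite (eqP (sP i)).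
rewrite !indexE ?ltn_ord // lx; case: ifP => // /negbT/low_last[j sx].
have := eqP (sP j); rewrite -{2}sx => /perm_inj xE.
by rewrite -xE last_posF in lx.
Qed.

Lemma hook_col_stab t : (t \in col_stab n la) =
  [forall x, (x \notin codom hook_pos) ==> (t x == x)].
Proof.
rewrite inE; apply/forallP/forallP => [tP x|tP x].
  rewrite codom_hook_pos negbK; apply/implyP => /andP[x0 xk].
  have := tP x; rewrite !offsetE ?ltn_ord // xk.
  by case: ifP => _; [move/eqP/val_inj-> | rewrite eq_sym => /eqP e; rewrite e in x0].
have [in_x|out] := boolP (x \in codom hook_pos); last first.
  by have := tP x; rewrite out => /eqP->.
have in_tx : t x \in codom hook_pos.
  apply/negPn/negP => out; have := tP (t x); rewrite out => /eqP/perm_inj e.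
  by rewrite e in_x in out.
have off0 y : y \in codom hook_pos -> reshape_offset la y = 0%N.
  rewrite codom_hook_pos offsetE ?ltn_ord // negb_and -leqNgt leqn0.
  by case: ifP => //= _; rewrite orbF => /eqP.
by rewrite !off0.
Qed.

(** The column stabilizer is the symmetric group of the first column. The row condition says that,
    after a column permutation, the letters of [r] and [s] agree on the leg. The signed count of
    such permutations is an antisymmetrized indicator, which [dif_asym] turns into a coboundary. *)
Lemma cf_young_hook s r : cf (rho F s (young_sym F n la)) r
  = dif F n k (asym F n k (place last_pos s)) (word hook_pos r).
Proof.
rewrite cf_rho dif_asym asymE /young_sym cf_sum.
under eq_bigr do rewrite cf_sum.
rewrite exchange_big /=.
transitivity (\sum_(t in col_stab n la)
    (-1) ^+ t * ((t^-1 * (r * s^-1))%g \in row_stab n la)%:R : F).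
  apply: eq_bigr => t _; under eq_bigr do rewrite cfZ cf_monom.
  rewrite -mulr_sumr; congr (_ * _).
  rewrite (eq_bigr (fun x => ((t^-1 * (r * s^-1))%g == x)%:R)) => [|x _]; last first.
    by congr (nat_of_bool _)%:R; apply/eqP/eqP => [->|<-]; rewrite ?mulKg ?mulKVg.
  rewrite big_mkcond /= (bigD1 (t^-1 * (r * s^-1))%g) //= eqxx big1 ?addr0 => [|x /negPf nx].
    by case: ifP.
  by rewrite eq_sym nx; case: ifP.
(* The inverse matches the factor [t^-1] of the row condition. *)
rewrite (reindex (fun t => ext_perm hook_pos_inj t^-1)) /=; last first.
  pose g q := odflt 1%g [pick t : 'S_k.+1 | ext_perm hook_pos_inj t^-1 == q].
  have gE t : g (ext_perm hook_pos_inj t^-1) = t.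
    rewrite /g; case: pickP => [t' /eqP/permP e|/(_ t)]; last by rewrite eqxx.
    apply: invg_inj; apply/permP => x; have := e (hook_pos x).
    by rewrite !ext_perm_pos => /hook_pos_inj.
  exists g => [t _ //|q Cq]; have {Cq} : q \in col_stab n la by exact: Cq.
  rewrite hook_col_stab => /forallP qP.
  have qP' x : x \notin codom hook_pos -> q x = x by move=> out; apply/eqP; apply: (implyP (qP x)).
  have [t ->] := ext_permP hook_pos_inj qP'.
  by rewrite -[t]invgK gE.
apply: eq_big => t.
  rewrite hook_col_stab; apply/forallP => x; apply/implyP => out.
  by rewrite ext_perm_out.
move=> _; rewrite odd_ext_perm odd_permV -ext_permV invgK; congr (_ * _).
rewrite hook_row_stab !ffunE; congr (nat_of_bool _)%:R.
apply/forallP/eqP => [sP|e i].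
  apply/ffunP => i; rewrite !ffunE -hook_posS.
  have := eqP (sP i); rewrite -hook_posS !permM ext_perm_pos => /(congr1 s).
  by rewrite permKV.
rewrite -hook_posS !permM ext_perm_pos.
have := congr1 (fun f : {ffun 'I_k -> 'I_n} => f i) e; rewrite !ffunE => ->.
by rewrite permK hook_posS.
Qed.

(** The two spaces are images of the regular module under maps with the same kernel: by
    [cf_young_hook] the coefficients of one image are the values of the other on injective tuples,
    and these determine an alternating function. *)
Lemma irr_chi_hook s : irr_chi F la s = tr_on (act F k.+1 s) (dif F n k @: Alt F n k).
Proof.
rewrite irr_chiE -(limg_asym_place last_pos_inj) -limg_comp.
apply: tr_on_eq_ker => [f|f|].
- apply: extend_equiv => t; apply/multilinP => r.
  by rewrite !cf_rho invMg mulgA.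
- by rewrite !comp_lfunE place_equiv asym_act dif_act.
set phi := extend _; set psi := (_ \o _)%VF.
have phiE f r : cf (phi f) r = psi f (word hook_pos r).
  rewrite {2}[f]monomE linear_sum sum_ffunE extendE cf_sum; apply: eq_bigr => t _.
  rewrite cfZ cf_young_hook linearZ /= ffunE.
  by rewrite !comp_lfunE extend_monom.
apply/vspaceP => f; rewrite !memv_ker; apply/eqP/eqP => f0; last first.
  by apply/multilinP => r; rewrite phiE f0 /cf !mxE ffunE.
apply/ffunP => u; rewrite [RHS]ffunE; have [iu|niu] := boolP (injectiveb u).
  have [r <-] := word_surj hook_pos_inj iu.
  by rewrite -phiE f0 /cf mxE.
apply: (alt_eq0 charF) => //; rewrite !comp_lfunE dif_asym.
exact: asym_is_alt.
Qed.

End Hook.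

End Places.

(** * Linear independence of the irreducible characters *)

Section FiberStabilizer.

Variables (T : eqType) (n : nat) (h : 'I_n -> T).
Implicit Types s t : 'S_n.

(** Row and column stabilizers are the cases where [h] is the row or the column of a cell. *)
Definition fiber_stab : {set 'S_n} := [set s : 'S_n | [forall i, h (s i) == h i]].

Lemma fiber_stabP s : reflect (forall i, h (s i) = h i) (s \in fiber_stab).
Proof. by rewrite inE; apply: (iffP forallP) => sP i; apply/eqP; apply: sP. Qed.

Lemma fiber_stab1 : 1%g \in fiber_stab.
Proof. by apply/fiber_stabP => i; rewrite perm1. Qed.

Lemma fiber_stabMl s t : s \in fiber_stab -> ((s * t)%g \in fiber_stab) = (t \in fiber_stab).
Proof.
move=> /fiber_stabP sP; apply/fiber_stabP/fiber_stabP => tP i; last by rewrite permM tP.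
by have := tP (s^-1%g i); rewrite permM permKV => ->; rewrite -(sP (s^-1%g i)) permKV.
Qed.

Lemma fiber_stabV s : (s^-1%g \in fiber_stab) = (s \in fiber_stab).
Proof.
apply/fiber_stabP/fiber_stabP => sP i; first by rewrite -(sP (s i)) permK.
by rewrite -{2}[i](permKV s) sP.
Qed.

Lemma fiber_stabMr s t : t \in fiber_stab -> ((s * t)%g \in fiber_stab) = (s \in fiber_stab).
Proof. by move=> tP; rewrite -(fiber_stabV (s * t)) invMg fiber_stabMl fiber_stabV. Qed.

Lemma tperm_fiber_stab i j : h i = h j -> tperm i j \in fiber_stab.
Proof. by move=> e; apply/fiber_stabP => x; case: tpermP => [->|->|]. Qed.

End FiberStabilizer.

Lemma leq_sumn_take (s : seq nat) k r : (k <= r)%N -> (sumn (take k s) <= sumn (take r s))%N.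
Proof.
by move=> le_kr; rewrite -(cat_take_drop k (take r s)) take_takel // sumn_cat leq_addr.
Qed.

Lemma reshape_index_lt (la : seq nat) i k : (i < sumn la)%N ->
  (reshape_index la i < k)%N = (i < sumn (take k la))%N.
Proof.
move=> lt_i; have := reshape_indexK la i; have := reshape_offsetP lt_i.
have := reshape_indexP lt_i.
set r := reshape_index la i; set c := reshape_offset la i.
rewrite /flatten_index => lt_r lt_c <-; apply/idP/idP => [lt_rk|].
  apply: leq_trans (leq_sumn_take _ lt_rk).
  by rewrite (take_nth 0) // sumn_rcons ltn_add2l.
apply: contraLR; rewrite -!leqNgt => le_kr.
exact: leq_trans (leq_sumn_take _ le_kr) (leq_addr _ _).
Qed.

Lemma card_low_rows n (la : seq nat) k : sumn la = n ->
  #|[set i : 'I_n | (reshape_index la i < k)%N]| = sumn (take k la).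
Proof.
move=> <-; set m := sumn (take k la).
have le_m : (m <= sumn la)%N.
  by rewrite -[in leqRHS](cat_take_drop k la) sumn_cat leq_addr.
rewrite (_ : [set _ | _] = [set widen_ord le_m i | i in 'I_m]); last first.
  apply/setP => i; rewrite !inE reshape_index_lt //; apply/idP/imsetP => [lt_i|[j _ ->]].
    by exists (Ordinal lt_i) => //; apply: val_inj.
  exact: (ltn_ord j).
by rewrite card_imset ?card_ord // => i j /(congr1 val)/= /val_inj.
Qed.

Section YoungIndependence.

Variables (F : fieldType) (n : nat).
Hypothesis charF : [pchar F] =i pred0.
Implicit Types (la mu : seq nat) (g s t : 'S_n).

Local Notation C mu := (col_stab n mu).
Local Notation R mu := (row_stab n mu).

Definition col_alt mu : 'End(multilin F n) := \sum_(t in C mu) (-1) ^+ t *: rho F t.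

Lemma col_altE mu f : col_alt mu f = \sum_(t in C mu) (-1) ^+ t *: rho F t f.
Proof.
by rewrite sum_lfunE; apply: eq_bigr => t _; rewrite scale_lfunE.
Qed.

Lemma rhoM s t f : rho F t (rho F s f) = rho F (s * t)%g f.
Proof.
by apply/multilinP => r; rewrite !cf_rho invMg mulgA.
Qed.

Lemma col_alt_rho mu t f : t \in C mu -> col_alt mu (rho F t f) = (-1) ^+ t *: col_alt mu f.
Proof.
move=> Ct; rewrite !col_altE scaler_sumr (reindex_inj (mulgI t^-1%g)) /=.
apply: eq_big => [r|r _]; first by rewrite fiber_stabMl // fiber_stabV.
by rewrite rhoM mulKVg odd_permM odd_permV signr_addb scalerA.
Qed.

Lemma col_alt_idem mu f : col_alt mu (col_alt mu f) = #|C mu|%:R *: col_alt mu f.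
Proof.
rewrite [X in col_alt mu X]col_altE linear_sum (eq_bigr (fun _ => col_alt mu f)) => [|t Ct].
  by rewrite sumr_const scaler_nat.
by rewrite linearZ /= col_alt_rho // scalerA -expr2 sqrr_sign scale1r.
Qed.

Lemma rho_young s la : rho F s (young_sym F n la)
  = \sum_(t in C la) (-1) ^+ t *: \sum_(r in R la) monom F (t * r * s)%g.
Proof.
rewrite linear_sum.
under eq_bigr do rewrite linear_sum.
rewrite exchange_big /=; apply: eq_bigr => t _; rewrite scaler_sumr.
by apply: eq_bigr => r _; rewrite linearZ /= rho_monom.
Qed.

(* von Neumann's argument: the transposition of two points lying in one row  *)
(* of la and moved by g to one column of mu is absorbed on both sides, with   *)
(* opposite signs.                                                            *)
Lemma col_alt_young0 la mu g (i j : 'I_n) : i != j ->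
    reshape_index la i = reshape_index la j ->
    reshape_offset mu (g i) = reshape_offset mu (g j) ->
  col_alt mu (rho F g (young_sym F n la)) = 0.
Proof.
move=> nij eq_row eq_col; rewrite rho_young linear_sum big1 // => q _.
rewrite linearZ /=; set f := \sum_(r in R la) _.
have Rt : tperm i j \in R la by apply: (tperm_fiber_stab (h := fun x : 'I_n => reshape_index la x)).
have Ct : tperm (g i) (g j) \in C mu.
  by apply: (tperm_fiber_stab (h := fun x : 'I_n => reshape_offset mu x)).
have fE : rho F (tperm (g i) (g j)) f = f.
  rewrite linear_sum /f [RHS](reindex_inj (mulIg (tperm i j))) /=.
  apply: eq_big => [r|r _].
    by rewrite (fiber_stabMr (h := fun x : 'I_n => reshape_index la x)).
  rewrite rho_monom -tpermJ /conjg; congr (monom F _).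
  by rewrite !mulgA mulgK.
have := col_alt_rho f Ct; rewrite fE odd_tperm (inj_eq perm_inj) nij expr1 scaleN1r.
move/eqP; rewrite -addr_eq0 -mulr2n -scaler_nat scaler_eq0 (natf_eq0 charF) /=.
by move/eqP->; rewrite scaler0.
Qed.

(** The coefficient at the identity is the order of the column stabilizer: row and column stabilizer
    meet trivially, so each column permutation cancels only against its inverse, with sign
    squared. *)
Lemma young_sym_neq0 mu : sumn mu = n -> col_alt mu (young_sym F n mu) != 0.
Proof.
move=> sz; apply/eqP => e.
have : cf (col_alt mu (young_sym F n mu)) 1%g = #|C mu|%:R.
  rewrite col_altE cf_sum (eq_bigr (fun _ => 1)) ?sumr_const // => t Ct.
  rewrite cfZ rho_young cf_sum (bigD1 t^-1%g) ?fiber_stabV //=.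
  rewrite cfZ cf_sum (bigD1 1%g) ?fiber_stab1 //= mulg1 mulVg cf_monom eqxx.
  rewrite big1 => [|r /andP[_ nr]]; last first.
    rewrite cf_monom eq_sym (can2_eq (mulgK _) (mulgKV _)) mul1g.
    by rewrite (can2_eq (mulKg _) (mulKVg _)) invgK mulgV (negPf nr).
  rewrite big1 ?addr0 ?mulr1 => [|q /andP[Cq nq]].
    by rewrite odd_permV -expr2 sqrr_sign.
  rewrite cfZ cf_sum big1 ?mulr0 // => r Rr; rewrite cf_monom.
  rewrite eq_sym (can2_eq (mulgK _) (mulgKV _)) mul1g.
  case: eqP => // qr; case/negP: nq; apply/eqP.
  have Cr : r \in C mu.
    by rewrite -(fiber_stabMl _ Cq) qr fiber_stabV.
  have r1 : r = 1%g.
    apply/permP => x; rewrite perm1; apply: val_inj.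
    have /fiber_stabP/(_ x) rR := Rr; have /fiber_stabP/(_ x) rC := Cr.
    by rewrite /= -[RHS](reshape_indexK mu) -rR -rC reshape_indexK.
  by rewrite -qr r1 mulg1.
rewrite e /cf mxE => /esym/eqP; rewrite (natf_eq0 charF) cards_eq0 => /eqP C0.
have : 1%g \in C mu by exact: fiber_stab1.
by rewrite C0 inE.
Qed.

Lemma tr_on_col_alt mu (U : {vspace multilin F n}) :
  tr_on (col_alt mu) U = \sum_(t in C mu) (-1) ^+ t * tr_on (rho F t) U.
Proof.
rewrite /tr_on; under [RHS]eq_bigr do rewrite mulr_sumr.
rewrite exchange_big; apply: eq_bigr => i _; rewrite col_altE linear_sum.
by apply: eq_bigr => t _; rewrite linearZ.
Qed.

Definition col_chi mu (chi : {ffun 'S_n -> F}) : F := \sum_(t in C mu) (-1) ^+ t * chi t.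

Definition young_space la : {vspace multilin F n} :=
  limg (extend (fun t => rho F t (young_sym F n la))).

Lemma col_chi_irr mu la : col_chi mu (irr_chi F la) = tr_on (col_alt mu) (young_space la).
Proof.
by rewrite tr_on_col_alt; apply: eq_bigr => t _; rewrite irr_chiE.
Qed.

Lemma rho_young_space la t f : f \in young_space la -> rho F t f \in young_space la.
Proof.
case/memv_imgP => v _ ->; apply/memv_imgP; exists (rho F t v); rewrite ?memvf //.
by rewrite (extend_equiv (act := rho F t)) // => s; rewrite rhoM.
Qed.

Lemma col_alt_young_space mu la f : f \in young_space la -> col_alt mu f \in young_space la.
Proof.
by move=> Yf; rewrite col_altE rpred_sum // => t _; rewrite memvZ // rho_young_space.
Qed.

Lemma tr_on_scale (V : vectType F) (f : 'End(V)) (U : {vspace V}) a :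
  {in U, forall u, f u = a *: u} -> tr_on f U = a * (\dim U)%:R.
Proof.
move=> fa; have bU := vbasisP U; rewrite /tr_on (eq_bigr (fun _ => a)) => [|i _].
  by rewrite sumr_const card_ord mulr_natr.
rewrite fa ?linearZ /= ?coord_free ?(basis_free bU) ?eqxx ?mulr1 //.
by apply: (basis_mem bU); rewrite mem_nth ?size_tuple.
Qed.

(** The value is the trace of [col_alt mu], which is the order of the column stabilizer times a
    projection; its image is nonzero by [young_sym_neq0]. *)
Lemma col_chi_irr_neq0 mu : sumn mu = n -> col_chi mu (irr_chi F mu) != 0.
Proof.
move=> sz; rewrite col_chi_irr.
rewrite (tr_on_ker_im (phi := col_alt mu) (g := col_alt mu)) //; last first.
  exact: col_alt_young_space.
rewrite (tr_on_scale (a := 0)) => [|u]; last first.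
  by rewrite memv_cap memv_ker scale0r => /andP[_ /eqP].
rewrite (tr_on_scale (a := #|C mu|%:R)) => [|u /memv_imgP[v _ ->]]; last first.
  exact: col_alt_idem.
rewrite mul0r add0r mulf_eq0 !(natf_eq0 charF) negb_or cards_eq0; apply/andP; split.
  by apply/set0Pn; exists 1%g; apply: fiber_stab1.
rewrite dimv_eq0; apply: contraNneq (young_sym_neq0 sz) => im0.
rewrite -memv0 -im0 memv_img //; apply/memv_imgP; exists (monom F 1%g); rewrite ?memvf //.
by rewrite extend_monom; apply/multilinP => r; rewrite cf_rho invg1 mulg1.
Qed.

Definition dominated la mu := forall k, (sumn (take k la) <= sumn (take k mu))%N.

(** The points of the first [k] rows of [la], moved by [g], are counted column by column of [mu]. A
    column contained in the first [k] rows of [mu] holds no more of them than it has cells; any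
    other column receives at most one point from each of the [k] rows. *)
Lemma no_collision_dominated la mu g :
    is_part n la -> is_part n mu ->
    (forall i j : 'I_n, reshape_index la i = reshape_index la j ->
      reshape_offset mu (g i) = reshape_offset mu (g j) -> i = j) ->
  dominated la mu.
Proof.
move=> /andP[_ /eqP szla] /andP[sort_mu /eqP szmu] noc k.
rewrite -(card_low_rows k szla) -(card_low_rows k szmu).
set A := [set i : 'I_n | _]; set B := [set i : 'I_n | (reshape_index mu i < k)%N].
rewrite -(card_imset _ (@perm_inj _ g)).
have lt_off (x : 'I_n) : (reshape_offset mu x < n)%N.
  by apply: leq_ltn_trans (ltn_ord x); apply: leq_subr.
pose off x : 'I_n := Ordinal (lt_off x).
rewrite -!sum1_card (partition_big off xpredT) //= [leqRHS](partition_big off xpredT) //=.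
apply: leq_sum => c _; rewrite !sum1dep_card.
have [/forallP full|] := boolP [forall x, (off x == c) ==> (reshape_index mu x < k)%N].
  apply: subset_leq_card; apply/subsetP => x; rewrite !inE => /andP[_ xc].
  by rewrite xc andbT; apply: (implyP (full x)).
rewrite negb_forall => /existsP[x]; rewrite negb_imply -leqNgt => /andP[/eqP xc le_kx].
(* Here column [c] has a cell in row [k] or beyond. The left side is at most [k], one point per row
   of [la], and the column has [k] cells in the first [k] rows. *)
apply: (@leq_trans k).
  have : {in [set y | (y \in [set g x0 | x0 in A]) && (off y == c)] &, injective
     (fun y => reshape_index la (g^-1%g y))}.
    move=> y z; rewrite !inE => /andP[_ /eqP yc] /andP[_ /eqP zc] e.
    apply: (@perm_inj _ g^-1%g); apply: noc => //; rewrite !permKV.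
    by have := congr1 val yc; rewrite -zc.
  set S := [set y | _] => inj_row.
  have sub : {subset [seq reshape_index la (g^-1%g y) | y <- enum S] <= iota 0 k}.
    move=> r /mapP[y]; rewrite mem_enum !inE => /andP[/imsetP[a]].
    by rewrite inE => lt_a -> _ ->; rewrite permK mem_iota.
  rewrite cardE -(size_map (fun y => reshape_index la (g^-1%g y))) -[leqRHS](size_iota 0 k).
  apply: uniq_leq_size => //; rewrite map_inj_in_uniq ?enum_uniq // => y z.
  by rewrite !mem_enum; apply: inj_row.
have cE : reshape_offset mu x = c by rewrite -xc.
(* The parts of [mu] decrease weakly, so a column that reaches row [k] or beyond meets all earlier
   rows. *)
have lt_cell r : (r < k)%N -> (c < nth 0 mu r)%N.
  move=> lt_rk; have lt_x : (x < sumn mu)%N by rewrite szmu.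
  have := reshape_offsetP lt_x; rewrite cE => /leq_trans; apply.
  have lt_x' := reshape_indexP lt_x.
  have le_rx := leq_trans (ltnW lt_rk) le_kx.
  have geqT : transitive geq by move=> a b d /= ba db; apply: leq_trans db ba.
  by apply: (sorted_leq_nth geqT leqnn 0%N sort_mu); rewrite ?inE ?(leq_ltn_trans le_rx).
pose cell (r : 'I_k) : 'I_n :=
  Ordinal (leq_trans (flatten_indexP (lt_cell r (ltn_ord r))) (eq_leq szmu)).
have cell_inj : injective cell.
  move=> r s /(congr1 (fun x : 'I_n => reshape_index mu x)) /=.
  by rewrite !flatten_indexKl ?lt_cell // => /val_inj.
rewrite -[leqLHS]card_ord -(card_imset _ cell_inj); apply: subset_leq_card.
apply/subsetP => _ /imsetP[r _ ->]; rewrite !inE /=.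
rewrite flatten_indexKl ?lt_cell // ltn_ord /=; apply/eqP/val_inj => /=.
by rewrite flatten_indexKr ?lt_cell.
Qed.

(** Without dominance every [g] puts two points of one row of [la] into one column of [mu], and then
    [col_alt mu] kills the corresponding generator of the Young ideal. *)
Lemma col_chi_irr_eq0 la mu : is_part n la -> is_part n mu ->
  ~ dominated la mu -> col_chi mu (irr_chi F la) = 0.
Proof.
move=> pla pmu ndom; rewrite col_chi_irr (tr_on_scale (a := 0)) ?mul0r // => f.
case/memv_imgP => v _ ->; rewrite scale0r extendE linear_sum big1 // => g _.
rewrite linearZ /=.
have [noc|] := boolP [forall i : 'I_n, forall j : 'I_n, [&& reshape_index la i == reshape_index la j
   & reshape_offset mu (g i) == reshape_offset mu (g j)] ==> (i == j)].
  case: ndom; apply: (@no_collision_dominated _ _ g) => // i j /eqP rij /eqP cij.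
  by apply/eqP; move/forallP: noc => /(_ i)/forallP/(_ j); rewrite rij cij.
rewrite negb_forall => /existsP[i]; rewrite negb_forall => /existsP[j].
rewrite negb_imply => /andP[/andP[/eqP rij /eqP cij] nij].
by rewrite (col_alt_young0 nij rij cij) scaler0.
Qed.

Local Notation intpart := {la : n.-tuple 'I_n.+1 | is_part n (map val la)}.
Implicit Types p q : intpart.

Definition parts_of p : seq nat := map val (val p).

Lemma parts_is_part p : is_part n (parts_of p).
Proof. exact: (valP p). Qed.

(** A numerical function that is strictly increasing for dominance, used to pick minimal
    partitions. *)
Definition total_partial p := (\sum_(k < n.+1) sumn (take k (parts_of p)))%N.

Lemma parts_inj p q : (forall k, sumn (take k (parts_of p)) = sumn (take k (parts_of q))) -> p = q.
Proof.
move=> e; apply/val_inj/val_inj; apply: (inj_map val_inj).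
have sz r : size (parts_of r) = n by rewrite size_map size_tuple.
apply: (@eq_from_nth _ 0%N) => [|i]; rewrite -/(parts_of p) -/(parts_of q) !sz // => lt_i.
have := e i.+1; rewrite !(take_nth 0) ?sz // !sumn_rcons e.
by move/addnI.
Qed.

Lemma dominated_eq p q : dominated (parts_of p) (parts_of q) ->
  (total_partial q <= total_partial p)%N -> p = q.
Proof.
move=> dom le_qp; apply: parts_inj => k.
have eq_sum : total_partial p = total_partial q.
  by apply/eqP; rewrite eqn_leq le_qp andbT; apply: leq_sum => i _; apply: dom.
have H (i : 'I_n.+1) : sumn (take i (parts_of p)) = sumn (take i (parts_of q)).
  have [_] := leqif_sum (fun (j : 'I_n.+1) (_ : true) => leqif_eq (dom j)).
  rewrite -/(total_partial p) -/(total_partial q) eq_sum eqxx => /esym/forallP/(_ i).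
  by move/implyP => /(_ isT)/eqP.
have sz r : size (parts_of r) = n by rewrite size_map size_tuple.
have [lt_k|le_k] := ltnP k n.+1; first exact: (H (Ordinal lt_k)).
by have := H ord_max; rewrite !take_oversize ?sz // ltnW.
Qed.

(** In a nontrivial relation take [mu] in the support with [total_partial] minimal. No other
    partition of the support is dominated by [mu], so [col_chi mu] isolates the term of [mu]. *)
Lemma irr_chi_indep (z : intpart -> F) :
  \sum_p z p *: (irr_chi F (parts_of p) : {ffun 'S_n -> F^o}) = 0 -> forall p, z p = 0.
Proof.
move=> e p0; apply/eqP/negPn/negP => z0.
case: (@arg_minnP _ p0 (fun p => z p != 0) total_partial z0) => mu zmu minmu.
have /eqP : \sum_p z p * col_chi (parts_of mu) (irr_chi F (parts_of p)) = 0.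
  transitivity (col_chi (parts_of mu) 0); last first.
    by rewrite /col_chi big1 // => t _; rewrite ffunE mulr0.
  rewrite -[X in col_chi _ X]e /col_chi; under eq_bigr do rewrite mulr_sumr.
  rewrite exchange_big; apply: eq_bigr => t _ /=; rewrite sum_ffunE mulr_sumr.
  by apply: eq_bigr => p _; rewrite !ffunE /GRing.scale /= mulrCA.
rewrite (bigD1 mu) //= big1 ?addr0 => [|p npmu].
  rewrite mulf_eq0 (negPf zmu) /=; apply/negP/col_chi_irr_neq0.
  by have /andP[_ /eqP] := parts_is_part mu.
have [->|zp] := eqVneq (z p) 0; first by rewrite mul0r.
rewrite col_chi_irr_eq0 ?mulr0 ?parts_is_part // => dom.
by case/eqP: npmu; apply: dominated_eq dom (minmu p zp).
Qed.

Lemma natf_inj (a b : nat) : a%:R = b%:R :> F -> a = b.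
Proof.
wlog le_ab : a b / (a <= b)%N => [H|/eqP].
  by case: (leqP a b) => [/H//|/ltnW/H + /esym e]; move/(_ e).
rewrite eq_sym -subr_eq0 -natrB // (natf_eq0 charF) subn_eq0 => le_ba.
by apply/eqP; rewrite eqn_leq le_ab.
Qed.

Lemma colength_irr (m : {ffun intpart -> nat}) :
  colength (\sum_p irr_chi F (n := n) (parts_of p) *+ m p) = (\sum_p m p)%N.
Proof.
rewrite /colength.
have -> : multiplicities (\sum_p irr_chi F (n := n) (parts_of p) *+ m p) = m; last by [].
apply: classical_sets.xget_unique => [//|m' /eqP].
rewrite eq_sym -subr_eq0 -sumrB => /eqP e.
apply/ffunP => p; apply: natf_inj; apply/eqP; rewrite -subr_eq0; apply/eqP.
apply: (irr_chi_indep (z := fun p => (m' p)%:R - (m p)%:R)).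
rewrite -[RHS]e; apply: eq_bigr => q _; rewrite scalerBl !scaler_nat.
by [].
Qed.

End YoungIndependence.

(** * Hook partitions and their colengths *)

Section Hooks.

Variables (F : fieldType) (n : nat).
Hypothesis charF : [pchar F] =i pred0.

(* The hook (n - k, 1^k), padded with z zeros. *)
Definition hook k z : seq nat := (n - k)%N :: nseq k 1%N ++ nseq z 0%N.

Lemma hook_cell k z i : (k < n)%N -> (i < n)%N ->
  reshape_index (hook k z) i = (if (i < n - k)%N then 0%N else (i - (n - k)).+1) /\
  reshape_offset (hook k z) i = (if (i < n - k)%N then i else 0%N).
Proof.
move=> lt_kn lt_in; case: ltnP => [lt_i|le_i].
  have iE : flatten_index (hook k z) 0 i = i by rewrite /flatten_index take0.
  have lt_c : (i < nth 0 (hook k z) 0)%N by [].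
  by split; rewrite -[in LHS]iE ?flatten_indexKl ?flatten_indexKr.
set r := (i - (n - k))%N.
have lt_r : (r < k)%N by rewrite ltn_subLR // subnK // ltnW.
have lt_c : (0 < nth 0 (hook k z) r.+1)%N.
  by rewrite /= nth_cat size_nseq lt_r nth_nseq lt_r.
have iE : flatten_index (hook k z) r.+1 0 = i.
  rewrite /flatten_index /= take_cat size_nseq lt_r take_nseq ?(ltnW lt_r) //.
  by rewrite sumn_nseq mul1n addn0 subnKC.
by split; rewrite -[in LHS]iE ?flatten_indexKl ?flatten_indexKr.
Qed.

(** The right side does not involve [z]: the unpadded hooks and the padded ones that index
    multiplicities have the same character. *)
Lemma irr_chi_hookE k z s : (k < n)%N ->
  irr_chi F (hook k z) s = tr_on (act F k.+1 s) (dif F n k @: Alt F n k).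
Proof.
by move=> lt_kn; apply: irr_chi_hook => // i lt_i; have [] := hook_cell z lt_kn lt_i.
Qed.

Local Notation intpart := {la : n.-tuple 'I_n.+1 | is_part n (map val la)}.

(** The padding brings the number of parts, 1 + k + z, to exactly n. *)
Lemma hook_part k : (k < n)%N -> {p : intpart | parts_of p = hook k (n - k.+1)}.
Proof.
move=> lt_kn; pose s := hook k (n - k.+1).
have szs : size (map (@inord n) s) == n.
  by rewrite size_map /= size_cat !size_nseq addnC -addnS subnK.
have sums : sumn s = n by rewrite /= sumn_cat !sumn_nseq mul1n mul0n addn0 subnK // ltnW.
have le_s x : x \in s -> (x < n.+1)%N.
  rewrite inE mem_cat !mem_nseq => /or3P[/eqP->|/andP[_ /eqP->]|/andP[_ /eqP->]] //.
    by rewrite ltnS leq_subr.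
  by rewrite ltnS (leq_ltn_trans _ lt_kn).
have valE : map val (map (@inord n) s) = s.
  rewrite -map_comp map_id_in // => x xs; rewrite /= inordK //; exact: le_s.
have part : is_part n (map val (Tuple szs)).
  rewrite [map val _]valE /is_part sums eqxx andbT /s /hook /=.
  rewrite path_sortedE; last by move=> a b c /= ba cb; apply: leq_trans cb ba.
  apply/andP; split.
    apply/allP => x; rewrite mem_cat !mem_nseq => /orP[] /andP[_ /eqP->] //=.
    by rewrite subn_gt0.
  have sorted0 j : sorted geq (nseq j 0%N) by elim: j => // -[].
  move: (n - k.+1)%N => j; clear -sorted0; elim: k => [|[|k] IH] /=; [exact: sorted0| |exact: IH].
  by case: j {IH} (sorted0 j).
by exists (exist _ (Tuple szs) part); apply: valE.
Qed.

Lemma colength_hooks (ks : seq nat) : all (fun k => k < n)%N ks ->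
  colength (\sum_(k <- ks) irr_chi F (n := n) (hook k 0)) = size ks.
Proof.
move=> /allP lt_ks.
(* [hook_part] requires a proof of k < n, hence the option; on [ks] the value is always [Some]. *)
pose P k : option intpart :=
  if (k < n)%N =P true is ReflectT lt_k then Some (sval (hook_part lt_k)) else None.
pose m := [ffun p : intpart => count (fun k => Some p == P k) ks].
have PE k : k \in ks -> exists2 p, P k = Some p & parts_of p = hook k (n - k.+1).
  move=> /lt_ks lt_k; rewrite /P; case: eqP => // lt_k'.
  by case: (hook_part lt_k') => p pE /=; exists p.
have -> : \sum_(k <- ks) irr_chi F (n := n) (hook k 0) = \sum_p irr_chi F (parts_of p) *+ m p.
  under [RHS]eq_bigr do rewrite ffunE -sum1_count -sumrMnr big_mkcond.
  rewrite exchange_big /= big_seq [RHS]big_seq; apply: eq_bigr => k ks_k.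
  have [p Pk pE] := PE k ks_k; rewrite (bigD1 p) //= Pk eqxx big1 ?addr0.
    rewrite mulr1n pE; apply/ffunP => s.
    by rewrite !irr_chi_hookE ?lt_ks.
  by move=> q nqp; case: eqP => // -[qp]; rewrite qp eqxx in nqp.
rewrite colength_irr // -sum1_size; under eq_bigr do rewrite ffunE -sum1_count big_mkcond.
rewrite exchange_big /= big_seq [RHS]big_seq; apply: eq_bigr => k /PE[p Pk _].
rewrite Pk (bigD1 p) //= eqxx big1 ?addn0 // => q nqp.
by case: eqP => // -[qp]; rewrite qp eqxx in nqp.
Qed.

End Hooks.

(** * Order signs *)

Section OrderSigns.

Variables (F : fieldType) (n : nat).
Hypothesis charF : [pchar F] =i pred0.
Implicit Types (s t : 'S_n) (p q : 'I_n).

Definition ordsgn (a b : nat) : F := if (a < b)%N then 1 else if (b < a)%N then -1 else 0.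

Lemma ordsgnE a b : ordsgn a b = (sgz (b%:Z - a%:Z))%:~R.
Proof.
rewrite /ordsgn; case: ltngtP => [ab|ba|->]; last by rewrite subrr sgz0.
  by rewrite gtr0_sgz // subr_gt0 ltz_nat.
by rewrite ltr0_sgz // subr_lt0 ltz_nat.
Qed.

(** The coboundary of the order sign of pairs is the order sign of triples, which yields phi_3 = d
    phi_2. *)
Lemma ordsgn_cocycle a b c :
  ordsgn b c - ordsgn a c + ordsgn a b = ordsgn a b * ordsgn a c * ordsgn b c.
Proof.
rewrite /ordsgn.
case: (ltngtP a b) => ab; case: (ltngtP b c) => bc; case: (ltngtP a c) => ac; try lia;
  by rewrite ?(subrr, subr0, sub0r, addr0, add0r, mulr0, mul0r, mulr1, mul1r, mulrNN, mulrN, mulNr,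
               opprK, oppr0, addNr, subrK, addrK).
Qed.

Lemma ordsgn_tperm p q (a b : 'I_n) : q = p.+1 :> nat ->
    ~~ [&& p \in [:: a; b] & q \in [:: a; b]] ->
  ordsgn (tperm p q a) (tperm p q b) = ordsgn a b.
Proof.
have neq_val (x y : 'I_n) : x <> y -> x <> y :> nat by move=> nxy /val_inj.
move=> qp; rewrite !inE /ordsgn.
case: (tpermP p q a) => [->|->|/neq_val nap /neq_val naq];
  case: (tpermP p q b) => [->|->|/neq_val nbp /neq_val nbq];
  rewrite ?eqxx ?ltnn ?orbT //= => _;
  by case: ltngtP => ?; case: ltngtP => ? //; lia.
Qed.

Definition order_sign k s : tens F n k :=
  [ffun u : {ffun 'I_k -> 'I_n} =>
     \prod_(i < k) \prod_(j < k | (i < j)%N) ordsgn (s^-1%g (u i)) (s^-1%g (u j))].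

Lemma order_signM k s t : order_sign k (s * t)%g = act F k t (order_sign k s).
Proof.
apply/ffunP => u; rewrite actE !ffunE; apply: eq_bigr => i _; apply: eq_bigr => j _.
by rewrite invMg !permM !ffunE.
Qed.

Lemma sgz_prod (I : Type) (r : seq I) (P : pred I) (G : I -> int) :
  sgz (\prod_(i <- r | P i) G i) = \prod_(i <- r | P i) sgz (G i).
Proof. by elim/big_rec2: _ => [|i x y _ <-]; rewrite ?sgz1 // sgzM. Qed.

(* The sign of a Vandermonde determinant. *)
Lemma order_sign_alt k s : is_alt (order_sign k s).
Proof.
pose V (u : {ffun 'I_k -> 'I_n}) := Vandermonde k (\row_j (s^-1%g (u j) : nat)%:Z).
have E u : order_sign k s u = (sgz (\det (V u)))%:~R.
  rewrite ffunE det_Vandermonde sgz_prod rmorph_prod; apply: eq_bigr => i _.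
  rewrite sgz_prod rmorph_prod; apply: eq_bigr => j _.
  by rewrite ordsgnE !mxE.
move=> u t; rewrite !E.
have -> : V (fcomp u t) = col_perm t (V u) by apply/matrixP => i j; rewrite !mxE ffunE.
rewrite col_permE det_mulmx det_perm sgzM rmorphM mulrC; congr (_ * _).
by rewrite odd_permV; case: (odd_perm t); rewrite ?expr1 ?expr0 ?sgzN1 ?sgz1 ?rmorphN1.
Qed.

(** Exchanging the letters in two adjacent places changes the relative order of these two letters
    only, so the sign changes exactly when both are observed. *)
Lemma order_sign_tperm k s (p q : 'I_n) (u : {ffun 'I_k -> 'I_n}) : q = p.+1 :> nat ->
  order_sign k (tperm p q * s)%g u
  = if (s p \in codom u) && (s q \in codom u) then - order_sign k s u
    else order_sign k s u.
Proof.
move=> qp; have npq : p != q by rewrite -val_eqE /= qp neq_ltn ltnSn.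
case: ifP => [/andP[/codomP[i spi] /codomP[j sqj]]|/negbT nb].
  have nij : i != j by apply: contraNneq npq => ij; rewrite -(inj_eq (@perm_inj _ s)) spi sqj ij.
  have := order_sign_alt s u (tperm i j); rewrite odd_tperm nij mulN1r => <-.
  have [iu|niu] := boolP (injectiveb u); last first.
    have niu' : ~~ injectiveb (fcomp u (tperm i j)).
      apply: contra niu => /injectiveP inj; apply/injectiveP => x y uxy.
      apply: (@perm_inj _ (tperm i j)); apply: inj; rewrite !ffunE !tpermK //.
    by rewrite !(alt_eq0 charF) //; apply: order_sign_alt.
  rewrite !ffunE; apply: eq_bigr => x _; apply: eq_bigr => y _.
  have H z : (tperm p q * s)^-1%g (u z) = s^-1%g (u (tperm i j z)).
    rewrite invMg tpermV permM; case: (tpermP i j z) => [->|->|niz njz].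
    - by rewrite -spi permK tpermL -sqj permK.
    - by rewrite -sqj permK tpermR -spi permK.
    rewrite tpermD // -(inj_eq (@perm_inj _ s)) permKV ?spi ?sqj.
      by rewrite (inj_eq (injectiveP _ iu)) eq_sym; apply/eqP.
    by rewrite (inj_eq (injectiveP _ iu)) eq_sym; apply/eqP.
  by rewrite !H !ffunE.
rewrite !ffunE; apply: eq_bigr => x _; apply: eq_bigr => y _.
rewrite invMg tpermV !permM ordsgn_tperm //; apply: contra nb.
have H (r z : 'I_n) : r = s^-1%g z -> s r = z by move=> ->; rewrite permKV.
rewrite !inE => /andP[pP qP]; apply/andP; split.
  by case/orP: pP => /eqP/H ->; apply: codom_f.
by case/orP: qP => /eqP/H ->; apply: codom_f.
Qed.

Lemma order_sign_word k (pos : 'I_k -> 'I_n) s :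
  (forall i j : 'I_k, (i < j)%N -> (pos i < pos j)%N) -> order_sign k s (word pos s) = 1.
Proof.
move=> pos_lt; rewrite ffunE big1 // => i _; rewrite big1 // => j lt_ij.
by rewrite !ffunE !permK /ordsgn pos_lt.
Qed.

(** A tuple in the support has length [k] and contains the [k] distinct entries of [u], so it is a
    rearrangement of [u], where the value is forced by alternation. *)
Lemma alt_unique k (w : tens F n k) (u : {ffun 'I_k -> 'I_n}) :
    is_alt w -> injectiveb u -> (forall v, w v != 0 -> forall i, u i \in codom v) ->
  w = w u *: asym F n k [ffun v => (v == u)%:R].
Proof.
move=> alt_w /injectiveP inj_u supp; apply/ffunP => v; rewrite ffunE asymE.
have [/existsP[t /eqP vt]|] := boolP [exists t : 'S_k, fcomp v t == u].
  have inj_v : injective v.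
    move=> x y vxy; apply: (@perm_inj _ t^-1%g); apply: inj_u.
    by rewrite -vt !ffunE !permKV.
  rewrite (bigD1 t) //= big1 ?addr0 => [|t' ntt']; rewrite ffunE.
    rewrite vt eqxx mulr1 -vt alt_w /GRing.scale /= mulrC mulrA -expr2 sqrr_sign mul1r //.
  case: eqP => [e|]; rewrite ?mulr0 //; case/eqP: ntt'; apply/permP => x.
  by apply: inj_v; have := congr1 (fun f : {ffun 'I_k -> 'I_n} => f x) e; rewrite -vt !ffunE.
rewrite negb_exists => /forallP nt; rewrite big1 ?scaler0 => [|t _]; last first.
  by rewrite ffunE (negPf (nt t)) mulr0.
apply/eqP/negPn/negP => wv; have uv := supp v wv.
pose g i := iinv (uv i); have gE i : v (g i) = u i by apply: f_iinv.
have g_inj : injective g by move=> x y /(congr1 v); rewrite !gE => /inj_u.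
case/negP: (nt (perm g_inj)); apply/eqP/ffunP => x.
by rewrite ffunE permE gE.
Qed.

End OrderSigns.

(** * The maps phi_k, their images on K, and the resulting characters *)

Lemma ffun_addE (T : finType) (V : nmodType) (f g : {ffun T -> V}) x : (f + g) x = f x + g x.
Proof. by rewrite ffunE. Qed.

Section Cocharacters.

Variables (F : fieldType) (n : nat).
Hypothesis charF : [pchar F] =i pred0.
Implicit Types (s t : 'S_n) (f : multilin F n).

Definition order_map k := extend (order_sign F (n := n) k).

Lemma order_map_equiv k s f : order_map k (rho F s f) = act F k s (order_map k f).
Proof. by apply: extend_equiv => t; apply: order_signM. Qed.

Lemma order_mapE k f u : order_map k f u = \sum_s cf f s * order_sign F k s u.
Proof. by rewrite extendE sum_ffunE; apply: eq_bigr => s _; rewrite ffunE. Qed.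

Lemma order_map_Alt k f : order_map k f \in Alt F n k.
Proof.
rewrite extendE rpred_sum // => s _; rewrite memvZ //; apply/(AltP charF).
exact: order_sign_alt.
Qed.

Lemma order_signE k s (u : {ffun 'I_k -> 'I_n}) : order_sign F k s u =
  \prod_(i < k) \prod_(j < k) (if (i < j)%N then ordsgn F (s^-1%g (u i)) (s^-1%g (u j)) else 1).
Proof. by rewrite ffunE; apply: eq_bigr => i _; rewrite big_mkcond. Qed.

Lemma dif_order_map f : dif F n 2 (order_map 2 f) = order_map 3 f.
Proof.
rewrite !extendE linear_sum; apply: eq_bigr => s _; rewrite linearZ; congr (_ *: _).
apply/ffunP => u; rewrite /= difE !big_ord_recl big_ord0 !order_signE !big_ord_recl !big_ord0 /=.
rewrite !ffunE !(mulr1, mul1r) expr1 mulN1r exprS expr1 mulN1r opprK mul1r addr0.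
have l10 : lift (lift ord0 ord0) ord0 = ord0 :> 'I_3 by apply: val_inj.
have l11 : lift (lift ord0 ord0) (lift ord0 ord0) = lift ord0 (lift ord0 ord0) :> 'I_3.
  exact: val_inj.
have l20 : lift (lift ord0 (lift ord0 ord0)) ord0 = ord0 :> 'I_3 by apply: val_inj.
have l21 : lift (lift ord0 (lift ord0 ord0)) (lift ord0 ord0) = lift ord0 ord0 :> 'I_3.
  exact: val_inj.
by rewrite l10 l11 l20 l21 addrA ordsgn_cocycle.
Qed.

(** [e] is the place whose letter survives in B, the last for [A1] and the first for [A1s]; the
    others are consecutive places in which letters can be exchanged without touching [e]. *)
Variables (e p1 p2 p3 p4 : 'I_n).
Hypotheses (p2E : p2 = p1.+1 :> nat) (p3E : p3 = p2.+1 :> nat) (p4E : p4 = p3.+1 :> nat).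
Hypotheses (ep1 : p1 != e) (ep2 : p2 != e) (ep3 : p3 != e) (ep4 : p4 != e).

Definition marked_map : 'Hom(multilin F n, tens F n 1) := extend (place F (fun _ : 'I_1 => e)).

(** A monomial with a commutator at places [p1], [p2]; [swap4] has a second commutator at [p3],
    [p4]. *)
Definition swap2 s : multilin F n := monom F s - monom F (tperm p1 p2 * s)%g.
Definition swap4 s : multilin F n := swap2 s - swap2 (tperm p3 p4 * s)%g.

Lemma marked_swap2 s : marked_map (swap2 s) = 0.
Proof.
rewrite linearB /= !extend_monom; apply/eqP; rewrite subr_eq0; apply/eqP.
apply/ffunP => u; rewrite !ffunE; congr (nat_of_bool (u == _))%:R.
by apply/ffunP => i; rewrite !ffunE permM tpermD.
Qed.

Lemma marked_swap4 s : marked_map (swap4 s) = 0.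
Proof. by rewrite linearB /= !marked_swap2 subrr. Qed.

Lemma order_map_monom k s : order_map k (monom F s) = order_sign F k s.
Proof. exact: extend_monom. Qed.

Lemma order_map_swap2 k s u : order_map k (swap2 s) u =
  if (s p1 \in codom u) && (s p2 \in codom u) then order_sign F k s u *+ 2 else 0.
Proof.
rewrite linearB /= !order_map_monom.
transitivity (order_sign F k s u - order_sign F k (tperm p1 p2 * s)%g u).
  by rewrite [LHS]ffunE [X in _ + X]ffunE.
by rewrite order_sign_tperm //; case: ifP; rewrite ?opprK ?subrr // mulr2n.
Qed.

Lemma order_map_swap4 k s u : order_map k (swap4 s) u =
  if [&& s p1 \in codom u, s p2 \in codom u, s p3 \in codom u & s p4 \in codom u]
  then order_sign F k s u *+ 4 else 0.
Proof.
rewrite linearB /=.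
transitivity (order_map k (swap2 s) u - order_map k (swap2 (tperm p3 p4 * s)%g) u).
  by rewrite [LHS]ffunE [X in _ + X]ffunE.
have neq (x y : 'I_n) : (x < y)%N -> y != x by move=> lt; rewrite -val_eqE neq_ltn lt orbT.
rewrite !order_map_swap2 !permM !tpermD ?neq //; try by rewrite ?p4E ?p3E ?p2E; lia.
rewrite order_sign_tperm //.
case: (s p1 \in _); case: (s p2 \in _); case: (s p3 \in _); case: (s p4 \in _) => //=;
  by rewrite ?subrr ?subr0 // mulNrn opprK -mulrnDr.
Qed.

Definition pos2 (i : 'I_2) : 'I_n := nth p1 [:: p1; p2] i.
Definition pos4 (i : 'I_4) : 'I_n := nth p1 [:: p1; p2; p3; p4] i.

Lemma pos2_lt (i j : 'I_2) : (i < j)%N -> (pos2 i < pos2 j)%N.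
Proof. by case: i j => [[|[|i]] //= ?] [[|[|j]] //= ?]; rewrite /pos2 /= p2E. Qed.

Lemma pos4_lt (i j : 'I_4) : (i < j)%N -> (pos4 i < pos4 j)%N.
Proof.
by case: i j => [[|[|[|[|i]]]] //= ?] [[|[|[|[|j]]]] //= ?]; rewrite /pos4 //= => _; lia.
Qed.

Lemma lt_inj k (pos : 'I_k -> 'I_n) :
  (forall i j : 'I_k, (i < j)%N -> (pos i < pos j)%N) -> injective pos.
Proof.
move=> pos_lt i j eq_ij; apply/val_inj; case: (ltngtP i j) => // /pos_lt.
  by rewrite eq_ij ltnn.
by rewrite eq_ij ltnn.
Qed.

Lemma order_map_swap2E s :
  order_map 2 (swap2 s) = 2%:R *: asym F n 2 (place F pos2 s).
Proof.
rewrite [LHS](alt_unique (u := word pos2 s)).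
- rewrite order_map_swap2 order_sign_word; last exact: pos2_lt.
  rewrite -[s p1](ffunE (fun i => s (pos2 i)) ord0).
  by rewrite -[s p2](ffunE (fun i => s (pos2 i)) (lift ord0 ord0)) !codom_f.
- by apply/(AltP charF); apply: order_map_Alt.
- by apply: word_inj; apply: lt_inj; apply: pos2_lt.
move=> v; rewrite order_map_swap2; case: ifP; last by rewrite eqxx.
by move=> /andP[v1 v2] _ [[|[|i]] //= lt_i]; rewrite ffunE.
Qed.

Lemma order_map_swap4E s :
  order_map 4 (swap4 s) = 4%:R *: asym F n 4 (place F pos4 s).
Proof.
rewrite [LHS](alt_unique (u := word pos4 s)).
- rewrite order_map_swap4 order_sign_word; last exact: pos4_lt.
  have wE i (lt_i : (i < 4)%N) : s (nth p1 [:: p1; p2; p3; p4] i) = word pos4 s (Ordinal lt_i).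
    by rewrite ffunE.
  rewrite (wE 0%N isT : s p1 = _) (wE 1%N isT : s p2 = _).
  by rewrite (wE 2%N isT : s p3 = _) (wE 3%N isT : s p4 = _) !codom_f.
- by apply/(AltP charF); apply: order_map_Alt.
- by apply: word_inj; apply: lt_inj; apply: pos4_lt.
move=> v; rewrite order_map_swap4; case: ifP; last by rewrite eqxx.
by move=> /and4P[v1 v2 v3 v4] _ [[|[|[|[|i]]]] //= lt_i]; rewrite ffunE.
Qed.

(** A pair cannot contain all four exchanged letters. *)
Lemma order_map2_swap4 s : order_map 2 (swap4 s) = 0.
Proof.
apply/ffunP => u; rewrite order_map_swap4 [RHS]ffunE; case: ifP => // /and4P[u1 u2 u3 u4].
have : (size (map s [:: p1; p2; p3; p4]) <= size (codom u))%N.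
  apply: uniq_leq_size => [|x].
    rewrite map_inj_uniq; last exact: perm_inj.
    by rewrite /= !inE -!val_eqE /=; lia.
  by rewrite !inE => /or4P[] /eqP->.
by rewrite size_codom card_ord.
Qed.

Definition marked_ker := lker marked_map.

Lemma extend_in_ker (W : vectType F) (phi : 'Hom(multilin F n, W)) (G : 'S_n -> multilin F n) f :
  (forall s, phi (G s) = 0) -> extend G f \in lker phi.
Proof.
move=> G0; rewrite memv_ker extendE linear_sum big1 // => s _.
by rewrite linearZ /= G0 scaler0.
Qed.

(** On combinations of the [G s] the map is, up to a nonzero scalar, antisymmetrization of places,
    which is onto by [limg_asym_place]. *)
Lemma limg_from_places k (pos : 'I_k -> 'I_n) (G : 'S_n -> multilin F n)
    (U : {vspace multilin F n}) a :
    injective pos -> a != 0 -> (forall s, order_map k (G s) = a *: asym F n k (place F pos s)) ->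
    (forall f, extend G f \in U) ->
  (order_map k @: U = Alt F n k)%VS.
Proof.
move=> inj_pos a0 GE GU; apply/vspaceP => w; apply/memv_imgP/idP => [[f _ ->]|].
  exact: order_map_Alt.
rewrite -(limg_asym_place charF inj_pos) => /memv_imgP[f _ ->].
exists (extend G (a^-1 *: f)); first exact: GU.
have -> : order_map k (extend G (a^-1 *: f)) = a *: asym F n k (extend (place F pos) (a^-1 *: f)).
  rewrite [extend G _]extendE [extend _ _]extendE !linear_sum.
  by apply: eq_bigr => s _; rewrite !linearZ /= GE.
by rewrite comp_lfunE !linearZ /= scalerA mulVf ?scale1r.
Qed.

Lemma order_map_marked_ker : (order_map 2 @: marked_ker = Alt F n 2)%VS.
Proof.
apply: (limg_from_places (lt_inj pos2_lt) _ order_map_swap2E); first by rewrite (natf_eq0 charF).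
by move=> f; apply: extend_in_ker; apply: marked_swap2.
Qed.

Lemma order_map_marked_ker2 : (order_map 4 @: (marked_ker :&: lker (order_map 2)) = Alt F n 4)%VS.
Proof.
apply: (limg_from_places (lt_inj pos4_lt) _ order_map_swap4E); first by rewrite (natf_eq0 charF).
move=> f; rewrite memv_cap; apply/andP.
split; apply: extend_in_ker; [exact: marked_swap4 | exact: order_map2_swap4].
Qed.

Hypothesis lt_4n : (4 < n)%N.

Lemma marked_map_equiv s f : marked_map (rho F s f) = act F 1 s (marked_map f).
Proof. exact: place_equiv. Qed.

Lemma limg_marked_map : limg marked_map = Alt F n 1.
Proof.
have ie : injective (fun _ : 'I_1 => e) by move=> i j _; rewrite (ord1 i) (ord1 j).
rewrite -(limg_asym_place charF ie) limg_comp; apply/vspaceP => w.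
have asym1 (v : tens F n 1) : asym F n 1 v = v.
  rewrite (asym_alt (w := v)) ?scale1r // => u t.
  have -> : t = 1%g by apply/permP => i; rewrite !ord1.
  rewrite odd_perm1 mul1r; congr (v _); apply/ffunP => i.
  by rewrite ffunE perm1.
apply/idP/memv_imgP => [wi|[v vi ->]]; last by rewrite asym1.
by exists w.
Qed.

Lemma rho_lker (W : vectType F) (phi : 'Hom(multilin F n, W)) (g : 'End(W)) s f :
  (forall f', phi (rho F s f') = g (phi f')) -> f \in lker phi -> rho F s f \in lker phi.
Proof. by move=> pe; rewrite !memv_ker pe => /eqP->; rewrite linear0. Qed.

Lemma rho_marked_ker s f : f \in marked_ker -> rho F s f \in marked_ker.
Proof. exact: rho_lker (marked_map_equiv s). Qed.

Lemma rho_order_ker k s f : f \in lker (order_map k) -> rho F s f \in lker (order_map k).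
Proof. exact: rho_lker (@order_map_equiv k s). Qed.

Local Notation T s U := (tr_on (rho F s) U).
Local Notation H k := (irr_chi F (n := n) (hook n k 0)).

Lemma tr_on_Alt k s : (k.+1 < n)%N -> tr_on (act F k.+1 s) (Alt F n k.+1) = H k s + H k.+1 s.
Proof.
by move=> lt_k; rewrite tr_on_AltS ?(ltn_trans _ lt_4n) // !irr_chi_hookE // ltnW.
Qed.

Lemma tr_on_marked_ker s : T s fullv = T s marked_ker + (H 0 s + H 1 s).
Proof.
rewrite (tr_on_ker_im (phi := marked_map) (g := act F 1 s)) ?capfv.
- by rewrite limg_marked_map tr_on_Alt // (ltn_trans _ lt_4n).
- by move=> f _; rewrite memvf.
- by move=> f _; apply: marked_map_equiv.
Qed.

Lemma tr_on_marked_ker2 s :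
  T s marked_ker = T s (marked_ker :&: lker (order_map 2)) + (H 1 s + H 2 s).
Proof.
rewrite (tr_on_ker_im (phi := order_map 2) (g := act F 2 s)).
- by rewrite order_map_marked_ker tr_on_Alt // (ltn_trans _ lt_4n).
- exact: rho_marked_ker.
- by move=> f _; apply: order_map_equiv.
Qed.

(** Since phi_3 = d phi_2 and phi_2 maps K onto Alt_2, the image of phi_3 is d(Alt_2), of character
    H_2. *)
Lemma tr_on_marked_ker3 s : T s marked_ker = T s (marked_ker :&: lker (order_map 3)) + H 2 s.
Proof.
rewrite (tr_on_ker_im (phi := order_map 3) (g := act F 3 s)).
- congr (_ + _); rewrite irr_chi_hookE ?(ltn_trans _ lt_4n) // -order_map_marked_ker -limg_comp.
  congr (tr_on _ _); apply/vspaceP => w.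
  apply/memv_imgP/memv_imgP => -[f Kf ->]; exists f => //; rewrite comp_lfunE.
    by rewrite dif_order_map.
  by rewrite -dif_order_map.
- exact: rho_marked_ker.
- by move=> f _; apply: order_map_equiv.
Qed.

Lemma tr_on_marked_ker24 s :
  T s (marked_ker :&: lker (order_map 2))
  = T s (marked_ker :&: lker (order_map 2) :&: lker (order_map 4)) + (H 3 s + H 4 s).
Proof.
rewrite (tr_on_ker_im (phi := order_map 4) (g := act F 4 s)).
- by rewrite order_map_marked_ker2 tr_on_Alt.
- move=> f; rewrite !memv_cap => /andP[K1f K2f]; apply/andP.
  by split; [exact: rho_marked_ker | exact: rho_order_ker].
- by move=> f _; apply: order_map_equiv.
Qed.

Lemma chi_z_marked_ker (A : subalg F) : vsp (Idz_mx A n) = marked_ker -> chi_z A n = H 0 + H 1.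
Proof.
move=> Idz; apply/ffunP => s; rewrite chi_zE Idz tr_on_marked_ker ffun_addE.
ring.
Qed.

Lemma chi_z_marked_ker3 (A : subalg F) :
  vsp (Idz_mx A n) = (marked_ker :&: lker (order_map 3))%VS -> chi_z A n = H 0 + H 1 + H 2.
Proof.
move=> Idz; apply/ffunP => s; rewrite chi_zE Idz tr_on_marked_ker tr_on_marked_ker3 !ffun_addE.
ring.
Qed.

Lemma chi_delta_marked_ker2 (A : subalg F) :
    vsp (Idz_mx A n) = marked_ker -> vsp (Id_mx A n) = (marked_ker :&: lker (order_map 2))%VS ->
  chi_delta A n = H 1 + H 2.
Proof.
move=> Idz Id; apply/ffunP => s; rewrite chi_deltaE Idz Id tr_on_marked_ker2 ffun_addE.
ring.
Qed.

(** Ker(phi_3) lies above Ker(phi_2) by H_1, since K exceeds them by H_2 and H_1 + H_2 respectively;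
    phi_4 adds H_3 + H_4. *)
Lemma chi_delta_marked_ker24 (A : subalg F) :
    vsp (Idz_mx A n) = (marked_ker :&: lker (order_map 3))%VS ->
    vsp (Id_mx A n) = (marked_ker :&: lker (order_map 2) :&: lker (order_map 4))%VS ->
  chi_delta A n = H 1 + H 3 + H 4.
Proof.
move=> Idz Id; apply/ffunP => s; rewrite chi_deltaE Idz Id !ffun_addE.
have := tr_on_marked_ker3 s; rewrite tr_on_marked_ker2 tr_on_marked_ker24.
by move/esym/(canRL (addrK _)) => ->; ring.
Qed.

End Cocharacters.

(** * Identities of direct sums; the algebras A1 and A1s *)

Section Evaluation.

Variables (F : fieldType) (n : nat).
Implicit Types (f : multilin F n) (A B : subalg F).

Definition coef_sum f : F := \sum_s cf f s.

Lemma eval_dsum A B f (a : 'I_n -> ambient (dsum A B)) :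
  eval f a = (eval f (A := A) (fun i => (a i).1), eval f (A := B) (fun i => (a i).2)).
Proof.
rewrite [LHS]surjective_pairing /eval.
rewrite (big_morph fst (id1 := 0) (op1 := +%R)) // (big_morph snd (id1 := 0) (op1 := +%R)) //.
congr (_, _); apply: eq_bigr => s _ /=; congr (_ *: _).
  by rewrite (big_morph fst (id1 := 1) (op1 := *%R)).
by rewrite (big_morph snd (id1 := 1) (op1 := *%R)).
Qed.

Lemma in_center_dsum A B (z : ambient (dsum A B)) :
  in_center z <-> in_center (A := A) z.1 /\ in_center (A := B) z.2.
Proof.
have [A0 _] := elts_submod A; have [B0 _] := elts_submod B.
split=> [[/andP[zA zB] zc]|[[zA zcA] [zB zcB]]].
  split; split=> // b bP.
    by have /(congr1 fst) := zc (b, 0) (introT andP (conj bP B0)).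
  by have /(congr1 snd) := zc (0, b) (introT andP (conj A0 bP)).
split=> [|b /andP[b1 b2]]; first exact/andP.
by rewrite [LHS]surjective_pairing [RHS]surjective_pairing /= zcA ?zcB.
Qed.

Lemma is_identity_dsum A B f :
  is_identity (dsum A B) f <-> is_identity A f /\ is_identity B f.
Proof.
have [A0 _] := elts_submod A; have [B0 _] := elts_submod B.
split=> [If|[IA IB] a aP]; last first.
  by rewrite eval_dsum IA ?IB // => i; have /andP[] := aP i.
split=> a aP.
  have /= := If (fun i => (a i, 0)) (fun i => introT andP (conj (aP i) B0)).
  by rewrite eval_dsum => /(congr1 fst).
have /= := If (fun i => (0, a i)) (fun i => introT andP (conj A0 (aP i))).
by rewrite eval_dsum => /(congr1 snd).
Qed.

Lemma is_central_dsum A B f :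
  is_central (dsum A B) f <-> is_central A f /\ is_central B f.
Proof.
have [A0 _] := elts_submod A; have [B0 _] := elts_submod B.
split=> [If|[IA IB] a aP]; last first.
  rewrite eval_dsum; apply/in_center_dsum; split.
    by apply: IA => i; have /andP[] := aP i.
  by apply: IB => i; have /andP[] := aP i.
split=> a aP.
  have /in_center_dsum[] := If (fun i => (a i, 0)) (fun i => introT andP (conj (aP i) B0)).
  by rewrite eval_dsum.
have /in_center_dsum[_] := If (fun i => (0, a i)) (fun i => introT andP (conj A0 (aP i))).
by rewrite eval_dsum.
Qed.

Lemma eval_multilinear A (I : finType) (b : I -> ambient A) (x : 'I_n -> I -> F) f :
  eval f (fun i => \sum_j x i j *: b j)
  = \sum_(g : {ffun 'I_n -> I}) (\prod_i x i (g i)) *: eval f (fun i => b (g i)).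
Proof.
rewrite /eval; under [RHS]eq_bigr do rewrite scaler_sumr.
rewrite exchange_big; apply: eq_bigr => s _ /=.
rewrite (bigA_distr_bigA (fun i j => x (s i) j *: b j)) scaler_sumr /=.
(* Place [i] of the monomial of [s] holds the letter [s i], so choices per place are choices per
   letter composed with [s]. *)
rewrite (reindex_onto (fun g : {ffun 'I_n -> I} => [ffun i => g (s i)])
                      (fun g : {ffun 'I_n -> I} => [ffun i => g (s^-1%g i)])) /=; last first.
  by move=> g _; apply/ffunP => i; rewrite !ffunE permK.
apply: eq_big => [g|g _].
  by apply/eqP/ffunP => i; rewrite !ffunE permKV.
rewrite scaler_prod !scalerA [in RHS]mulrC; congr (_ * _ *: _).
  by rewrite [RHS](reindex_inj (@perm_inj _ s)); apply: eq_bigr => i _; rewrite ffunE.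
by apply: eq_bigr => i _; rewrite ffunE.
Qed.

End Evaluation.

Section Marked.

Variables (F : fieldType) (n : nat).

Lemma marked_map_eq0 (e : 'I_n) (f : multilin F n) :
  marked_map F e f = 0 <-> forall j, \sum_(s : 'S_n | s e == j) cf f s = 0.
Proof.
have E u : marked_map F e f u = \sum_(s : 'S_n | s e == u ord0) cf f s.
  rewrite extendE sum_ffunE [RHS]big_mkcond; apply: eq_bigr => s _.
  rewrite !ffunE (_ : (u == _) = (s e == u ord0)); last first.
    apply/eqP/eqP => [->|e_u]; first by rewrite ffunE.
    by apply/ffunP => i; rewrite ffunE ord1 e_u.
  by case: ifP; rewrite ?scaler0 // /GRing.scale /= mulr1.
split=> [e0 j|f0].
  by have := E [ffun _ => j]; rewrite e0 !ffunE => <-.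
by apply/ffunP => u; rewrite E f0 ffunE.
Qed.

Lemma marked_coef_sum (e : 'I_n) (f : multilin F n) : marked_map F e f = 0 -> coef_sum f = 0.
Proof.
move/marked_map_eq0 => f0; rewrite /coef_sum (partition_big (fun s : 'S_n => s e) xpredT) //=.
by rewrite big1.
Qed.

(** The common shape of [A1] and [A1s]: the weight is the (1,1) entry with [e] last, or the (2,2)
    entry with [e] first. *)
Variables (A : subalg F) (weight : ambient A -> F) (e : 'I_n) (u v : ambient A).
Hypothesis prodE : forall a : 'I_n -> ambient A, (forall i, a i \in elts A) ->
  \prod_i a i = (\prod_(i | i != e) weight (a i)) *: a e.
Hypotheses (Au : u \in elts A) (Av : v \in elts A).
Hypotheses (wu : weight u = 1) (wv : weight v = 0) (v0 : v != 0).
Hypothesis center0 : forall z : ambient A, in_center z -> z = 0.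

(** With [v] for x_j and [u] for the other letters, only the monomials with x_j in place [e]
    survive, each giving [v]. Conversely, all monomials with the same letter in place [e] have the
    same value. *)
Lemma is_identity_marked f : is_identity A f <-> f \in marked_ker F e.
Proof.
rewrite memv_ker; split=> [If|/eqP/marked_map_eq0 f0 a Aa].
  apply/eqP/marked_map_eq0 => j.
  have Aa i : (if i == j then v else u) \in elts A by case: ifP.
  have /eqP := If _ Aa; rewrite /eval (bigID (fun s : 'S_n => s e == j)) /=.
  rewrite addrC big1 ?add0r => [|s nsj]; last first.
    rewrite prodE // (bigD1 (s^-1%g j)) /=; last first.
      by rewrite (can2_eq (permKV s) (permK s)) eq_sym.
    by rewrite permKV eqxx wv mul0r scale0r scaler0.
  rewrite (eq_bigr (fun s => cf f s *: v)) => [|s /eqP sj].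
    by rewrite -scaler_suml scaler_eq0 (negPf v0) orbF => /eqP.
  rewrite prodE // sj eqxx big1 ?scale1r // => i nie.
  by rewrite -sj (inj_eq perm_inj) (negPf nie).
rewrite /eval (partition_big (fun s : 'S_n => s e) xpredT) //= big1 // => j _.
rewrite (eq_bigr (fun s => cf f s *: ((\prod_(i | i != j) weight (a i)) *: a j))).
  by rewrite -scaler_suml f0 scale0r.
move=> s /eqP sj; rewrite prodE // sj; congr (_ *: (_ *: _)).
rewrite [RHS](reindex_inj (@perm_inj _ s)); apply: eq_bigl => i.
by rewrite -sj (inj_eq perm_inj).
Qed.

Lemma is_central_marked f : is_central A f <-> f \in marked_ker F e.
Proof.
rewrite -is_identity_marked; split=> If a Aa; first by apply: center0; apply: If.
by rewrite If //; apply: in_center0.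
Qed.

End Marked.

Section A1.

Variable F : fieldType.

Lemma span2P (V : vectType F) (x y z : V) :
  z \in <<[:: x; y]>>%VS -> exists a b, z = a *: x + b *: y.
Proof.
rewrite span_cons span_seq1 => /memv_addP[_ /vlineP[a ->] [_ /vlineP[b ->] ->]].
by exists a, b.
Qed.

Lemma munitE m i j k l : (0 < i <= m.+1)%N -> (0 < j <= m.+1)%N ->
  munit F m i j k l = ((k.+1 == i) && (l.+1 == j))%:R.
Proof.
move=> /andP[i0 im] /andP[j0 jm]; rewrite mxE -!val_eqE /= !inordK ?prednK //.
by rewrite -(eqSS k) -(eqSS l) !prednK.
Qed.

Lemma A1_elts x : x \in elts (A1 F) -> exists a b, x = a *: munit F 1 1 1 + b *: munit F 1 1 2.
Proof. exact: span2P. Qed.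

Lemma A1s_elts x : x \in elts (A1s F) -> exists a b, x = a *: munit F 1 2 2 + b *: munit F 1 1 2.
Proof. exact: span2P. Qed.

Definition ord2 : 'I_2 := lift ord0 ord0.

Lemma lin2_mxE m (X Y : 'M[F]_m) a b i j : (a *: X + b *: Y) i j = a * X i j + b * Y i j.
Proof. by rewrite !mxE. Qed.

Lemma A1_mulE x y : x \in elts (A1 F) -> y \in elts (A1 F) -> x * y = x ord0 ord0 *: y.
Proof.
move=> /A1_elts[a [b ->]] /A1_elts[c [d ->]].
have -> : (a *: munit F 1 1 1 + b *: munit F 1 1 2) ord0 ord0 = a.
  by rewrite lin2_mxE !munitE //= mulr1 mulr0 addr0.
rewrite mulrDl !mulrDr -!(scalerAl, scalerAr) !munitM //=.
by rewrite !scaler0 !addr0 scalerDr.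
Qed.

Lemma A1s_mulE x y : x \in elts (A1s F) -> y \in elts (A1s F) -> x * y = y ord2 ord2 *: x.
Proof.
move=> /A1s_elts[a [b ->]] /A1s_elts[c [d ->]].
have -> : (c *: munit F 1 2 2 + d *: munit F 1 1 2) ord2 ord2 = c.
  by rewrite lin2_mxE !munitE //= mulr1 mulr0 addr0.
rewrite mulrDl !mulrDr -!(scalerAl, scalerAr) !munitM //=.
by rewrite !scaler0 !addr0 scalerDr !scalerA ![_ * c]mulrC.
Qed.

Lemma munit_neq0 m i j : (0 < i <= m.+1)%N -> (0 < j <= m.+1)%N -> munit F m i j != 0.
Proof.
move=> im jm; apply/eqP => /matrixP/(_ (inord i.-1) (inord j.-1))/eqP.
by rewrite !mxE !eqxx oner_eq0.
Qed.

Lemma A1_center z : in_center (A := A1 F) z -> z = 0.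
Proof.
move=> [Az zc]; have A11 : munit F 1 1 1 \in elts (A1 F) by apply: memv_span; rewrite !inE eqxx.
have A12 : munit F 1 1 2 \in elts (A1 F) by apply: memv_span; rewrite !inE eqxx orbT.
have /eqP := zc _ A12; rewrite !A1_mulE // munitE //= scale0r scaler_eq0.
rewrite (negPf (@munit_neq0 1 1 2 isT isT)) orbF => /eqP z0.
by have := zc _ A11; rewrite !A1_mulE // munitE //= z0 scale0r scale1r.
Qed.

Lemma A1s_center z : in_center (A := A1s F) z -> z = 0.
Proof.
move=> [Az zc]; have A22 : munit F 1 2 2 \in elts (A1s F) by apply: memv_span; rewrite !inE eqxx.
have A12 : munit F 1 1 2 \in elts (A1s F) by apply: memv_span; rewrite !inE eqxx orbT.
have /esym/eqP := zc _ A12; rewrite !A1s_mulE // munitE //= scale0r scaler_eq0.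
rewrite (negPf (@munit_neq0 1 1 2 isT isT)) orbF => /eqP z0.
by have := zc _ A22; rewrite !A1s_mulE // munitE //= z0 scale0r scale1r.
Qed.

Lemma A1_prodE m (a : 'I_m.+1 -> 'M[F]_2) : (forall i, a i \in elts (A1 F)) ->
  \prod_i a i = (\prod_(i | i != ord_max) a i ord0 ord0) *: a ord_max.
Proof.
move=> Aa; rewrite big_ord_recr [in RHS]big_mkcond big_ord_recr /= eqxx mulr1.
elim/big_rec2: _ => [|i y c _ IH]; first by rewrite mul1r scale1r.
rewrite -mulrA IH -scalerAr A1_mulE // scalerA mulrC ifT //.
by rewrite -val_eqE neq_ltn /= ltn_ord.
Qed.

Lemma A1s_prodE m (a : 'I_m.+1 -> 'M[F]_2) : (forall i, a i \in elts (A1s F)) ->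
  \prod_i a i = (\prod_(i | i != ord0) a i ord2 ord2) *: a ord0.
Proof.
move=> Aa; rewrite big_ord_recl [in RHS]big_mkcond big_ord_recl /= mul1r.
elim/big_rec2: _ => [|i y c _ IH]; first by rewrite mulr1 scale1r.
by rewrite mulrA (A1s_mulE (Aa ord0) (Aa _)) -scalerAl IH scalerA.
Qed.

Lemma A1_marked m (f : multilin F m.+1) :
  (is_identity (A1 F) f <-> f \in marked_ker F ord_max) /\
  (is_central (A1 F) f <-> f \in marked_ker F ord_max).
Proof.
have A11 : munit F 1 1 1 \in elts (A1 F) by apply: memv_span; rewrite !inE eqxx.
have A12 : munit F 1 1 2 \in elts (A1 F) by apply: memv_span; rewrite !inE eqxx orbT.
have w1 : munit F 1 1 1 ord0 ord0 = 1 by rewrite munitE.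
have w2 : munit F 1 1 2 ord0 ord0 = 0 by rewrite munitE.
have v0 := @munit_neq0 1 1 2 isT isT.
pose w (x : 'M[F]_2) := x ord0 ord0.
split.
  exact: (is_identity_marked (A := A1 F) (weight := w) (@A1_prodE m) A11 A12 w1 w2 v0 f).
exact: (is_central_marked (A := A1 F) (weight := w) (@A1_prodE m) A11 A12 w1 w2 v0 A1_center f).
Qed.

Lemma A1s_marked m (f : multilin F m.+1) :
  (is_identity (A1s F) f <-> f \in marked_ker F ord0) /\
  (is_central (A1s F) f <-> f \in marked_ker F ord0).
Proof.
have A22 : munit F 1 2 2 \in elts (A1s F) by apply: memv_span; rewrite !inE eqxx.
have A12 : munit F 1 1 2 \in elts (A1s F) by apply: memv_span; rewrite !inE eqxx orbT.
have w1 : munit F 1 2 2 ord2 ord2 = 1 by rewrite munitE.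
have w2 : munit F 1 1 2 ord2 ord2 = 0 by rewrite munitE.
have v0 := @munit_neq0 1 1 2 isT isT.
pose w (x : 'M[F]_2) := x ord2 ord2.
split.
  exact: (is_identity_marked (A := A1s F) (weight := w) (@A1s_prodE m) A22 A12 w1 w2 v0 f).
exact: (is_central_marked (A := A1s F) (weight := w) (@A1s_prodE m) A22 A12 w1 w2 v0 A1s_center f).
Qed.

End A1.

(** * The algebra A2 *)

Section Words.

Variables (R : nzRingType) (n : nat) (a : 'I_n -> R) (J : pred 'I_n).
Implicit Types s : 'S_n.

(** The letters not replaced with 1, in their order of occurrence in the monomial of [s]. *)
Definition letters s : seq 'I_n := [seq x <- [seq s i | i <- enum 'I_n] | J x].

Lemma mem_letters s x : (x \in letters s) = J x.
Proof.
rewrite mem_filter; case: (J x) => //=; apply/mapP; exists (s^-1%g x).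
  by rewrite mem_enum.
by rewrite permKV.
Qed.

Lemma uniq_letters s : uniq (letters s).
Proof. by rewrite filter_uniq // map_inj_uniq ?enum_uniq //; apply: perm_inj. Qed.

Lemma sorted_letters s : sorted (fun x y => s^-1%g x < s^-1%g y)%N (letters s).
Proof.
apply: sorted_filter => [x y z|]; first exact: ltn_trans.
rewrite sorted_map /relpre.
rewrite (eq_sorted (e' := relpre (fun i : 'I_n => i : nat) ltn)) => [|i j].
  by rewrite -sorted_map val_enum_ord iota_ltn_sorted.
by rewrite /= !permK.
Qed.

Hypothesis aJ : forall p, ~~ J p -> a p = 1.

Lemma prod_letters s : \prod_(i < n) a (s i) = \prod_(x <- letters s) a x.
Proof.
rewrite big_filter big_map [index_enum _]unlock -enumT [RHS]big_mkcond; apply: eq_bigr => i _.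
by case: ifP => // /negbT/aJ.
Qed.

Lemma prod_letters0 s : #|J| = 0%N -> \prod_(i < n) a (s i) = 1.
Proof.
move/card0_eq => J0; rewrite prod_letters big_seq big_pred0 // => x.
by rewrite mem_letters; apply: J0.
Qed.

Lemma size_letters s : size (letters s) = #|J|.
Proof. by rewrite -(card_uniqP (uniq_letters s)); apply: eq_card => x; rewrite mem_letters. Qed.

Lemma prod_letters1 s p : J =i pred1 p -> \prod_(i < n) a (s i) = a p.
Proof.
move=> Jp; rewrite prod_letters; have := size_letters s; rewrite (eq_card Jp) card1.
case: (letters s) (mem_letters s) => [|x [|//]] //= memx _; rewrite big_seq1.
have := memx x; rewrite inE eqxx => /esym Jx; have := Jp x.
by rewrite !inE /in_mem /= Jx => /esym/eqP->.
Qed.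

Lemma prod_letters2 s p q : p != q -> J =i pred2 p q ->
  \prod_(i < n) a (s i) = if (s^-1%g p < s^-1%g q)%N then a p * a q else a q * a p.
Proof.
move=> npq Jp; rewrite prod_letters; have := size_letters s.
rewrite (eq_card Jp) card2 npq; have := sorted_letters s; have := uniq_letters s.
case: (letters s) (mem_letters s) => [|x [|y [|//]]] //= memx; rewrite !inE andbT => nxy.
rewrite andbT => lt_xy _; rewrite big_cons big_seq1.
have Jxy z : (z \in [:: x; y]) -> (z == p) || (z == q).
  by rewrite memx => Jz; have := Jp z; rewrite !inE /in_mem /= Jz => <-.
have := Jxy y; rewrite !inE eqxx orbT => /(_ isT); have := Jxy x; rewrite !inE eqxx => /(_ isT).
case/orP=> /eqP xE; case/orP=> /eqP yE; rewrite xE yE ?eqxx // in nxy lt_xy *.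
  by rewrite lt_xy.
by rewrite ltnNge ltnW.
Qed.

Lemma prod_letters3 s : (2 < #|J|)%N ->
    (forall x y z, J x -> J y -> J z -> a x * a y * a z = 0) ->
  \prod_(i < n) a (s i) = 0.
Proof.
rewrite -(size_letters s) prod_letters => + a3.
case: (letters s) (mem_letters s) => [|x [|y [|z l]]] //= memx _.
rewrite !big_cons !mulrA a3 ?mul0r //; rewrite -memx !inE eqxx ?orbT //.
Qed.

End Words.

Section A2.

Variables (F : fieldType) (n : nat).
Hypothesis charF : [pchar F] =i pred0.
Implicit Types (f : multilin F n) (s : 'S_n).

Lemma in_center_sum (A : subalg F) (I : finType) (P : pred I) (c : I -> F) (z : I -> ambient A) :
  (forall i, P i -> in_center (z i)) -> in_center (\sum_(i | P i) c i *: z i).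
Proof.
have [A0 AL] := elts_submod A => zc.
elim/big_rec: _ => [|i x Pi [xA xc]]; first exact: in_center0.
have [ziA zic] := zc i Pi; split; first exact: AL.
by move=> b Ab; rewrite mulrDl mulrDr -scalerAl -scalerAr zic // xc.
Qed.

Definition A2_base (i : 'I_4) : 'M[F]_3 := (A2_gen F)`_i.

Lemma A2_base0 : A2_base ord0 = 1.
Proof.
apply/matrixP => i j; rewrite /A2_base /= 2!mxE !munitE // !mxE.
by case: i j => [[|[|[|i]]] //= ?] [[|[|[|j]]] //= ?]; rewrite ?addr0 ?add0r.
Qed.

Lemma A2_base_elts i : A2_base i \in elts (A2 F).
Proof. by apply: memv_span; rewrite mem_nth. Qed.

Lemma A2_expand x : x \in elts (A2 F) ->
  x = \sum_(j < 4) coord (in_tuple (A2_gen F)) j x *: A2_base j.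
Proof. by move=> Ax; apply: (coord_span (X := in_tuple (A2_gen F)) Ax). Qed.

Lemma A2_base_mul (i j : 'I_4) : i != ord0 -> j != ord0 ->
  A2_base i * A2_base j = 0 \/ A2_base i * A2_base j = munit F 2 1 3.
Proof.
by case: i j => [[|[|[|[|i]]]] //= ?] [[|[|[|[|j]]]] //= ?] _ _;
  rewrite /A2_base /= munitM //=; [left | left | right | left | left | left | left | left | left].
Qed.

Lemma A2_base_mul3 (i j k : 'I_4) : i != ord0 -> j != ord0 -> k != ord0 ->
  A2_base i * A2_base j * A2_base k = 0.
Proof.
move=> i0 j0; case: (A2_base_mul i0 j0) => ->; first by rewrite mul0r.
by case: k => [[|[|[|[|k]]]] //= ?] _; rewrite /A2_base /= munitM.
Qed.

Lemma A2_e13_center : in_center (A := A2 F) (munit F 2 1 3).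
Proof.
split; first exact: (A2_base_elts (lift ord0 (lift ord0 ord0))).
move=> b /A2_expand ->; rewrite mulr_sumr mulr_suml; apply: eq_bigr => j _.
rewrite -scalerAr -scalerAl; congr (_ *: _).
have [->|] := eqVneq j ord0; first by rewrite A2_base0 mulr1 mul1r.
by case: j => [[|[|[|[|j]]]] //= ?] _; rewrite /A2_base /= !munitM.
Qed.

Lemma A2_base_mul_center (i j : 'I_4) : i != ord0 -> j != ord0 ->
  in_center (A := A2 F) (A2_base i * A2_base j).
Proof.
move=> i0 j0; case: (A2_base_mul i0 j0) => ->; first exact: in_center0.
exact: A2_e13_center.
Qed.

Lemma order_sign2 s (u : {ffun 'I_2 -> 'I_n}) :
  order_sign F 2 s u = ordsgn F (s^-1%g (u ord0)) (s^-1%g (u (lift ord0 ord0))).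
Proof. by rewrite order_signE !big_ord_recl !big_ord0 /= !(mulr1, mul1r). Qed.

Definition pair_fun (p q : 'I_n) : {ffun 'I_2 -> 'I_n} := [ffun i => if i == ord0 then p else q].

Lemma order_map_pair f p q :
  order_map F n 2 f (pair_fun p q) = \sum_s cf f s * ordsgn F (s^-1%g p) (s^-1%g q).
Proof.
by rewrite order_mapE; apply: eq_bigr => s _; rewrite order_sign2 !ffunE.
Qed.

(** With at most one non-unit letter, or at least three, all monomials have the same value, and the
    coefficient sum annihilates it. With two, the value is a multiple of the central element
    e_13. *)
Lemma A2_eval_base f (g : 'I_n -> 'I_4) (v := eval (A := A2 F) f (fun i => A2_base (g i))) :
  coef_sum f = 0 -> in_center v /\ (order_map F n 2 f = 0 -> v = 0).
Proof.
move=> f0; pose J := [set p | g p != ord0].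
have aJ p : ~~ (p \in J) -> A2_base (g p) = 1 by rewrite inE negbK => /eqP->; apply: A2_base0.
have const x : (forall s, \prod_(i < n) A2_base (g (s i)) = x) -> v = 0.
  move=> wE; rewrite /v eval_extend; under eq_bigr do rewrite wE.
  by rewrite -scaler_suml -/(coef_sum f) f0 scale0r.
have central0 : v = 0 -> in_center v /\ (order_map F n 2 f = 0 -> v = 0).
  by move=> ->; split=> //; apply: in_center0.
have [lt_2J|] := ltnP 2 #|J|.
  apply: central0; apply: (const 0) => s.
  apply: (prod_letters3 (a := fun i => A2_base (g i)) (J := mem J)) => // x y z.
  by rewrite /= !inE; apply: A2_base_mul3.
rewrite leq_eqVlt ltnS leq_eqVlt ltnS leqn0.
case/or3P=> [/cards2P[p [q [npq JE]]]|/cards1P[p JE]|/eqP J0].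
- have [gp gq] : g p != ord0 /\ g q != ord0.
    have : p \in J by rewrite JE !inE eqxx.
    have : q \in J by rewrite JE !inE eqxx orbT.
    by rewrite !inE.
  have wE s : \prod_(i < n) A2_base (g (s i)) = if (s^-1%g p < s^-1%g q)%N
      then A2_base (g p) * A2_base (g q) else A2_base (g q) * A2_base (g p).
    apply: (prod_letters2 (a := fun i => A2_base (g i)) (J := mem J)) => // x.
    by rewrite JE !inE.
  split.
    rewrite /v eval_extend; apply: in_center_sum => s _; rewrite wE.
    by case: ifP => _; apply: A2_base_mul_center.
  move=> om0; have := order_map_pair f p q; rewrite om0 ffunE => /esym om_pq.
  set X := A2_base (g p) * A2_base (g q) in wE; set Y := A2_base (g q) * A2_base (g p) in wE.
  (* Each word equals [X] or [Y]: twice it is [X + Y] plus the order sign times [X - Y]. *)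
  have : 2%:R *: v = coef_sum f *: (X + Y) +
     (\sum_s cf f s * ordsgn F (s^-1%g p) (s^-1%g q)) *: (X - Y).
    rewrite /v eval_extend scaler_sumr !scaler_suml -big_split; apply: eq_bigr => s _ /=.
    rewrite wE -[_ * ordsgn _ _ _ *: _]scalerA -scalerDr scalerA mulrC -scalerA; congr (_ *: _).
    rewrite /ordsgn scaler_nat mulr2n; case: ltngtP => [lt|gt|/val_inj/perm_inj/eqP].
    - by rewrite scale1r addrACA subrr addr0.
    - by rewrite scaleN1r opprB addrC addrA subrK.
    - by rewrite (negPf npq).
  rewrite f0 om_pq !scale0r addr0 => /eqP; rewrite scaler_eq0 (natf_eq0 charF) /=.
  by move/eqP.
- apply: central0; apply: (const (A2_base (g p))) => s.
  by apply: (prod_letters1 (a := fun i => A2_base (g i)) (J := mem J)) => // x; rewrite JE !inE.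
apply: central0; apply: (const 1) => s.
by apply: (prod_letters0 (a := fun i => A2_base (g i)) (J := mem J)).
Qed.

Lemma eval_ext (A : subalg F) f (a b : 'I_n -> ambient A) : a =1 b -> eval f a = eval f b.
Proof.
by move=> e; apply: eq_bigr => s _; congr (_ *: _); apply: eq_bigr => i _; rewrite e.
Qed.

Lemma A2_central f : coef_sum f = 0 -> is_central (A2 F) f.
Proof.
move=> f0 a Aa; rewrite (eval_ext f (fun i => A2_expand (Aa i))).
rewrite (eval_multilinear (A := A2 F)); apply: in_center_sum => g _.
by have [] := A2_eval_base g f0.
Qed.

Lemma A2_identity f : coef_sum f = 0 -> order_map F n 2 f = 0 -> is_identity (A2 F) f.
Proof.
move=> f0 om0 a Aa; rewrite (eval_ext f (fun i => A2_expand (Aa i))).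
rewrite (eval_multilinear (A := A2 F)) big1 // => g _.
by have [_ ->] := A2_eval_base g f0; rewrite ?scaler0.
Qed.

Lemma A2_identity_order f : is_identity (A2 F) f -> order_map F n 2 f = 0.
Proof.
move=> If; have D (p q : 'I_n) : p != q -> \sum_(s : 'S_n | (s^-1%g p < s^-1%g q)%N) cf f s = 0.
  (* e_12 is put for [p], e_23 for [q] and 1 elsewhere: since e_23 e_12 = 0, only monomials with [p]
     before [q] contribute. *)
  move=> npq; pose g i : 'I_4 := if i == p then lift ord0 ord0 else
    if i == q then ord_max else ord0.
  have /eqP := If (fun i => A2_base (g i)) (fun i => A2_base_elts (g i)).
  rewrite eval_extend (bigID (fun s : 'S_n => s^-1%g p < s^-1%g q)%N) /= addrC.
  have wE s : \prod_(i < n) A2_base (g (s i)) = if (s^-1%g p < s^-1%g q)%N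
      then munit F 2 1 3 else 0.
    rewrite (prod_letters2 (a := fun i => A2_base (g i)) (J := pred2 p q) _ _ npq) //.
      by rewrite /g !eqxx eq_sym (negPf npq) /A2_base /= !munitM.
    move=> i; rewrite inE negb_or /g => /andP[/negPf-> /negPf->].
    exact: A2_base0.
  rewrite big1 ?add0r => [|s /negPf ns]; last by rewrite wE ns scaler0.
  rewrite (eq_bigr (fun s => cf f s *: munit F 2 1 3)) => [|s lt]; last by rewrite wE lt.
  by rewrite -scaler_suml scaler_eq0 (negPf (@munit_neq0 F 2 1 3 isT isT)) orbF => /eqP.
apply/ffunP => u; rewrite [RHS]ffunE; have [iu|niu] := boolP (injectiveb u); last first.
  by apply: (alt_eq0 charF _ niu); apply/(AltP charF); apply: order_map_Alt.
set p := u ord0; set q := u (lift ord0 ord0).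
have npq : p != q by rewrite (inj_eq (injectiveP _ iu)).
rewrite order_mapE; transitivity (\sum_(s : 'S_n | (s^-1%g p < s^-1%g q)%N) cf f s
    - \sum_(s : 'S_n | (s^-1%g q < s^-1%g p)%N) cf f s); last first.
  by rewrite !D ?subrr // eq_sym.
rewrite [X in X - _]big_mkcond [X in _ - X]big_mkcond -sumrB; apply: eq_bigr => s _.
rewrite order_sign2 /ordsgn; case: ltngtP => _;
  by rewrite ?mulr1 ?subr0 ?sub0r ?mulrN1 ?mulr0 ?subrr.
Qed.

End A2.

(** * The Grassmann algebra *)

Section PairProducts.

Variables (R : comNzRingType) (n : nat).

Lemma prod_pairs (Y : 'I_n -> 'I_n -> R) : (forall i, Y i i = 1) ->
  \prod_i \prod_j Y i j = \prod_(i < n) \prod_(j < n | (i < j)%N) (Y i j * Y j i).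
Proof.
move=> Y1; transitivity ((\prod_(i < n) \prod_(j < n | (i < j)%N) Y i j) *
    \prod_(i < n) \prod_(j < n | (j < i)%N) Y i j).
  rewrite -big_split; apply: eq_bigr => i _ /=.
  rewrite (bigD1 i) //= Y1 mul1r (bigID (fun j : 'I_n => i < j)%N) /=.
  congr (_ * _); apply: eq_bigl => j; rewrite -val_eqE /=; by case: ltngtP.
rewrite [X in _ * X](exchange_big_dep xpredT) //= -big_split; apply: eq_bigr => i _ /=.
by rewrite -big_split.
Qed.

Lemma prod_codom k (u : 'I_k -> 'I_n) (X : 'I_n -> R) : injective u ->
  (forall p, p \notin codom u -> X p = 1) -> \prod_p X p = \prod_i X (u i).
Proof.
move=> inj_u X1; rewrite -(big_imset (h := u) X (A := predT)) /=; last by move=> i j _ _ /inj_u.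
rewrite [RHS]big_mkcond; apply: eq_bigr => p _; case: ifP => // /negbT np; apply: X1.
by apply: contra np => /codomP[i ->]; apply: imset_f.
Qed.

End PairProducts.

Section GrassmannWords.

Variables (F : fieldType) (m : nat).
Implicit Types (S T : {set 'I_m}).

Definition inv_sign S T : F := (-1) ^+ inversions S T.

Lemma inversions_cup n S (T : 'I_n -> {set 'I_m}) :
  (forall i j, i != j -> [disjoint T i & T j]) ->
  inversions S (\bigcup_i T i) = (\sum_i inversions S (T i))%N.
Proof.
move=> dT; rewrite /inversions [RHS]exchange_big; apply: eq_bigr => i _.
exact: partition_disjoint_bigcup.
Qed.

Lemma inversionsC S T : [disjoint S & T] ->
  (inversions S T + inversions T S = #|S| * #|T|)%N.
Proof.
move=> dST; rewrite /inversions [X in (_ + X)%N]exchange_big -big_split /=.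
transitivity (\sum_(i in S) \sum_(j in T) 1)%N; last by rewrite sum_nat_const sum1_card.
apply: eq_bigr => i Si; rewrite -big_split; apply: eq_bigr => j Tj /=.
case: ltngtP => // /val_inj ij; have := disjointFr dST Si.
by rewrite -ij Tj.
Qed.

Lemma inv_signC S T : [disjoint S & T] -> inv_sign T S = inv_sign S T * (-1) ^+ (#|S| * #|T|)%N.
Proof.
by move=> dST; rewrite -(inversionsC dST) exprD /inv_sign signrMK.
Qed.

Lemma prod_grassmann_e n (T : 'I_n -> {set 'I_m}) :
    (forall i j, i != j -> [disjoint T i & T j]) ->
  \prod_i grassmann_e F (T i) = (\prod_(i < n) \prod_(j < n | (i < j)%N) inv_sign (T i) (T j))
    *: grassmann_e F (\bigcup_i T i).
Proof.
elim: n T => [|n IH] T dT.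
  by rewrite !big_ord0 scale1r; apply/ffunP => S; rewrite !ffunE.
rewrite !big_ord_recl IH => [|i j nij]; last by apply: dT.
rewrite -scalerAr grassmann_eM.
have -> : [disjoint T ord0 & \bigcup_i T (lift ord0 i)].
  by apply/bigcup_disjointP => i _; apply: dT.
rewrite scalerA; congr (_ *: _); rewrite mulrC; congr (_ * _).
  rewrite [RHS]big_mkcond big_ord_recl /= mul1r.
  rewrite -/(inv_sign _ _) /inv_sign inversions_cup => [|i j nij]; last by apply: dT.
  by rewrite (big_morph (fun k => (-1 : F) ^+ k) (id1 := 1) (op1 := *%R)) // => x y; rewrite exprD.
apply: eq_bigr => i _; rewrite [RHS]big_mkcond big_ord_recl /= mul1r -big_mkcond /=.
by apply: eq_bigl => j; rewrite /bump /= !add1n ltnS.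
Qed.

Lemma prod_grassmann_e0 n (T : 'I_n -> {set 'I_m}) i j :
  i != j -> ~~ [disjoint T i & T j] -> \prod_i grassmann_e F (T i) = 0.
Proof.
elim: n T i j => [|n IH] T i j; first by case: i.
move=> nij mij; rewrite big_ord_recl.
have [/forallP dT|] := boolP [forall i : 'I_n,
    forall j : 'I_n, (i != j) ==> [disjoint T (lift ord0 i) & T (lift ord0 j)]]; last first.
  rewrite negb_forall => /existsP[k]; rewrite negb_forall => /existsP[l].
  by rewrite negb_imply => /andP[nkl mkl]; rewrite (IH _ k l nkl mkl) mulr0.
have dT' k l : k != l -> [disjoint T (lift ord0 k) & T (lift ord0 l)].
  by move=> nkl; have /forallP/(_ l)/implyP := dT k; apply.
rewrite (prod_grassmann_e dT') -scalerAr grassmann_eM ifF ?scaler0 //.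
apply: contraNF mij => /bigcup_disjointP d0.
move: nij; case: (unliftP ord0 i) => [k|] ->; case: (unliftP ord0 j) => [l|] -> //.
- by rewrite (inj_eq lift_inj); apply: dT'.
- by rewrite disjoint_sym d0.
- by rewrite d0.
Qed.

Lemma card_disjoint_cup n (T : 'I_n -> {set 'I_m}) :
  (forall i j, i != j -> [disjoint T i & T j]) -> #|\bigcup_i T i| = (\sum_i #|T i|)%N.
Proof.
move=> dT; rewrite -sum1_card partition_disjoint_bigcup //.
by apply: eq_bigr => i _; rewrite sum1_card.
Qed.

Section Word.

Variables (n : nat) (g : 'I_n -> {set 'I_m}).
Implicit Types (s : 'S_n) (p q : 'I_n).
Hypothesis disj_g : forall p q, p != q -> [disjoint g p & g q].

Definition word_factor s p q : F :=
  if (s^-1%g p < s^-1%g q)%N then inv_sign (g p) (g q) else 1.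

Lemma grassmann_word s : \prod_i grassmann_e F (g (s i))
  = (\prod_p \prod_q word_factor s p q) *: grassmann_e F (\bigcup_p g p).
Proof.
rewrite prod_grassmann_e => [|i j nij]; last by rewrite disj_g // (inj_eq perm_inj).
congr (_ *: grassmann_e F _); last by rewrite [RHS](reindex_inj (@perm_inj _ s)).
rewrite [RHS](reindex_inj (@perm_inj _ s)); apply: eq_bigr => i _.
rewrite [RHS](reindex_inj (@perm_inj _ s)) big_mkcond; apply: eq_bigr => j _.
by rewrite /word_factor !permK.
Qed.

Lemma word_factorpp s p : word_factor s p p = 1.
Proof. by rewrite /word_factor ltnn. Qed.

Definition odd_letters : {set 'I_n} := [set p | odd #|g p|].

Lemma odd_card_cup : odd #|\bigcup_p g p| = odd #|odd_letters|.
Proof.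
rewrite card_disjoint_cup // -sum1_card [in RHS]big_mkcond /=.
rewrite (big_morph odd oddD (erefl : odd 0 = false)).
rewrite [RHS](big_morph odd oddD (erefl : odd 0 = false)).
by apply: eq_bigr => p _; rewrite inE; case: (odd _).
Qed.

Lemma card_odd_letters : (#|odd_letters| <= m)%N.
Proof.
apply: (@leq_trans #|\bigcup_p g p|); last by rewrite -[leqRHS]card_ord max_card.
rewrite card_disjoint_cup // -sum1_card big_mkcond /=; apply: leq_sum => p _.
by rewrite inE; case: #|g p| => [|k]; rewrite //=; case: ifP.
Qed.

Definition odd_enum : {ffun 'I_#|odd_letters| -> 'I_n} := [ffun i => enum_val i].

(** Basis elements with disjoint supports commute unless both have odd degree, when they
    anticommute. So reordering a word costs the order sign of its odd letters. *)
Lemma grassmann_word_odd : exists c, forall s, \prod_i grassmann_e F (g (s i))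
  = order_sign F _ s odd_enum *: (c *: grassmann_e F (\bigcup_p g p)).
Proof.
(* The coefficient of the word whose letters are in increasing order. *)
exists (\prod_(p < n) \prod_(q < n | (p < q)%N) inv_sign (g p) (g q)) => s.
rewrite grassmann_word scalerA; congr (_ *: _).
rewrite prod_pairs; last exact: word_factorpp.
transitivity (\prod_(p < n) \prod_(q < n | (p < q)%N) (inv_sign (g p) (g q) *
    (if (p \in odd_letters) && (q \in odd_letters)
     then ordsgn F (s^-1%g p) (s^-1%g q) else 1))).
  apply: eq_bigr => p _; apply: eq_bigr => q lt_pq.
  have npq : p != q by rewrite -val_eqE neq_ltn /= lt_pq.
  rewrite /word_factor /ordsgn !inE; case: ltngtP => [lt|gt|/val_inj/perm_inj/eqP].
  - by rewrite !mulr1 if_same mulr1.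
  - by rewrite mul1r inv_signC ?disj_g // -signr_odd oddM; case: (_ && _).
  - by rewrite (negPf npq).
under eq_bigr do rewrite big_split; rewrite big_split mulrC /=; congr (_ * _).
rewrite order_signE; under eq_bigr do rewrite big_mkcond.
have enum_codom p : p \notin codom odd_enum -> p \notin odd_letters.
  apply: contra => Jp; apply/codomP; exists (enum_rank_in Jp p).
  by rewrite ffunE enum_rankK_in.
have enum_inj : injective odd_enum by move=> i j; rewrite !ffunE => /enum_val_inj.
have enum_lt (i j : 'I_#|odd_letters|) : (odd_enum i < odd_enum j)%N = (i < j)%N.
  have mono (k l : 'I_#|odd_letters|) : (k < l)%N -> (odd_enum k < odd_enum l)%N.
    move=> lt_kl; rewrite !ffunE !(enum_val_nth (odd_enum i)).
    rewrite -!(nth_map _ 0%N (fun x : 'I_n => x : nat)) -?cardE //.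
    have srt : sorted ltn [seq nat_of_ord i | i <- enum odd_letters].
      rewrite sorted_map; apply: sorted_filter; first by move=> x y z; apply: ltn_trans.
      by have := iota_ltn_sorted 0 n; rewrite -val_enum_ord sorted_map enumT.
    by apply: (sorted_ltn_nth ltn_trans 0%N srt); rewrite ?inE ?size_map -?cardE.
  apply/idP/idP => [|/mono //]; apply: contraTT; rewrite -!leqNgt leq_eqVlt.
  by case/predU1P => [/val_inj->|/mono/ltnW].
rewrite (prod_codom enum_inj) => [|p /enum_codom Jp]; last first.
  by rewrite big1 // => q _; rewrite (negPf Jp) if_same.
apply: eq_bigr => i _; rewrite (prod_codom enum_inj) => [|q /enum_codom Jq]; last first.
  by rewrite (negPf Jq) andbF if_same.
by apply: eq_bigr => j _; rewrite enum_lt !ffunE !enum_valP.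
Qed.

End Word.

Lemma grassmann_eC S T : [disjoint S & T] ->
  grassmann_e F T * grassmann_e F S
  = (-1) ^+ (#|S| * #|T|)%N *: (grassmann_e F S * grassmann_e F T).
Proof.
move=> dST; rewrite !grassmann_eM disjoint_sym dST setUC scalerA; congr (_ *: _).
by rewrite -/(inv_sign T S) (inv_signC dST) mulrC.
Qed.

Lemma grassmann_expand (x : grassmann F m) : x = \sum_S x S *: grassmann_e F S.
Proof.
apply/ffunP => T; rewrite sum_ffunE (bigD1 T) //= big1 ?addr0 => [|S nST].
  by rewrite !ffunE eqxx /GRing.scale /= mulr1.
by rewrite !ffunE eq_sym (negPf nST) scaler0.
Qed.

Lemma grassmann_e_even_central S (x : grassmann F m) : ~~ odd #|S| ->
  grassmann_e F S * x = x * grassmann_e F S.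
Proof.
move=> evenS; rewrite [x]grassmann_expand mulr_sumr mulr_suml; apply: eq_bigr => T _.
rewrite -scalerAr -scalerAl; congr (_ *: _).
have [dST|mST] := boolP [disjoint S & T].
  by rewrite (grassmann_eC dST) -signr_odd oddM (negPf evenS) scale1r.
by rewrite !grassmann_eM (negPf mST) disjoint_sym (negPf mST).
Qed.

Lemma grassmann_e_neq0 S : grassmann_e F S != 0.
Proof. by apply/eqP => /ffunP/(_ S)/eqP; rewrite !ffunE eqxx oner_eq0. Qed.

Section Generators.

Variables (n k : nat) (le_km : (k <= m)%N) (u : {ffun 'I_k -> 'I_n}).
Hypothesis inj_u : injective u.
Implicit Types (s : 'S_n) (p q : 'I_n).

(* The i-th letter u i is replaced with the i-th generator, the others with 1. *)
Definition gen_letters p : {set 'I_m} := [set widen_ord le_km i | i in [pred i | u i == p]].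

Lemma gen_letters_u i : gen_letters (u i) = [set widen_ord le_km i].
Proof.
apply/setP => x; rewrite inE; apply/imsetP/eqP => [[j]|->].
  by rewrite inE => /eqP/inj_u -> ->.
by exists i; rewrite ?inE.
Qed.

Lemma gen_letters_out p : p \notin codom u -> gen_letters p = set0.
Proof.
move=> out; apply/setP => x; rewrite inE; apply/imsetP => -[j].
by rewrite inE => /eqP up; rewrite -up codom_f in out.
Qed.

Lemma gen_letters_disjoint p q : p != q -> [disjoint gen_letters p & gen_letters q].
Proof.
move=> npq; apply/pred0P => x /=; apply/negP => /andP[/imsetP[i]].
rewrite inE => /eqP up ->; move=> /imsetP[j]; rewrite inE => /eqP uq.
move/(congr1 (@nat_of_ord m)) => /= e; have ij : i = j by apply: val_inj.
by rewrite -up -uq ij eqxx in npq.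
Qed.

Lemma gen_letters_cup : \bigcup_p gen_letters p = [set x : 'I_m | (x < k)%N].
Proof.
apply/setP => x; rewrite inE; apply/bigcupP/idP => [[p _ /imsetP[i _ ->]]|lt_x].
  exact: (ltn_ord i).
exists (u (Ordinal lt_x)); rewrite // gen_letters_u inE; apply/eqP; exact: val_inj.
Qed.

Lemma grassmann_word_gen s : \prod_i grassmann_e F (gen_letters (s i))
  = order_sign F k s u *: grassmann_e F [set x : 'I_m | (x < k)%N].
Proof.
rewrite (grassmann_word gen_letters_disjoint) gen_letters_cup; congr (_ *: _).
have inv0l T : inv_sign set0 T = 1 by rewrite /inv_sign /inversions big_set0.
have inv0r S : inv_sign S set0 = 1.
  by rewrite /inv_sign /inversions big1 // => i _; rewrite big_set0.
rewrite (prod_codom inj_u) => [|p /gen_letters_out p0]; last first.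
  by rewrite big1 // => q _; rewrite /word_factor p0 inv0l if_same.
transitivity (\prod_i \prod_j word_factor gen_letters s (u i) (u j)).
  apply: eq_bigr => i _; rewrite (prod_codom inj_u) // => q /gen_letters_out q0.
  by rewrite /word_factor q0 inv0r if_same.
rewrite prod_pairs; last by move=> i; apply: word_factorpp.
rewrite ffunE; apply: eq_bigr => i _; apply: eq_bigr => j lt_ij.
rewrite /word_factor !gen_letters_u /inv_sign /inversions !big_set1 /=.
have -> : (j < i)%N = false by apply/negbTE; rewrite -leqNgt ltnW.
rewrite lt_ij expr0 expr1 /ordsgn.
case: ltngtP => [_|_|/val_inj/perm_inj/inj_u ij]; rewrite ?mulr1 ?mul1r //.
by rewrite ij ltnn in lt_ij.
Qed.

End Generators.

End GrassmannWords.

Section G4.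

Variables (F : fieldType) (n : nat).
Hypothesis charF : [pchar F] =i pred0.
Implicit Types (f : multilin F n) (s : 'S_n).

Lemma order_map_coef_sum k f u : (k <= 1)%N -> order_map F n k f u = coef_sum f.
Proof.
move=> k1; rewrite order_mapE; apply: eq_bigr => s _; rewrite order_signE big1 ?mulr1 // => i _.
rewrite big1 // => j _; rewrite ltnNge (leq_trans _ (leq0n i)) //.
by rewrite -ltnS (leq_trans (ltn_ord j)).
Qed.

(** Overlapping supports give 0. Otherwise the value is phi_k(f) at the [k] odd letters times a
    basis element, which is even, hence central, for even [k]. Four generators force k <= 4, and
    phi_0, phi_1 are the coefficient sum. *)
Lemma G4_eval_base f (g : 'I_n -> {set 'I_4})
    (v := eval (A := G4 F) f (fun p => grassmann_e F (g p))) : coef_sum f = 0 ->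
  (order_map F n 3 f = 0 -> in_center v) /\
  (order_map F n 2 f = 0 -> order_map F n 3 f = 0 -> order_map F n 4 f = 0 -> v = 0).
Proof.
move=> f0; have [/forallP dis|] :=
  boolP [forall p : 'I_n, forall q : 'I_n, (p != q) ==> [disjoint g p & g q]]; last first.
  rewrite negb_forall => /existsP[p]; rewrite negb_forall => /existsP[q].
  rewrite negb_imply => /andP[npq mpq].
  have v0 : v = 0.
    rewrite /v eval_extend big1 // => s _.
    rewrite (@prod_grassmann_e0 F 4 n (fun i => g (s i)) (s^-1%g p) (s^-1%g q)) ?scaler0 //.
      by rewrite (inj_eq perm_inj).
    by rewrite !permKV.
  by split=> // _; rewrite v0; apply: in_center0.
have disj p q : p != q -> [disjoint g p & g q].
  by move=> npq; have /forallP/(_ q)/implyP := dis p; apply.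
have [c wE] := grassmann_word_odd F disj.
have vE : v = order_map F n _ f (odd_enum g) *: (c *: grassmann_e F (\bigcup_p g p)).
  rewrite order_mapE scaler_suml /v eval_extend; apply: eq_bigr => s _.
  by rewrite wE scalerA.
have := odd_card_cup disj; have := card_odd_letters disj; rewrite {}vE.
move: (odd_enum g); case: #|odd_letters g| => [|[|[|[|[|k]]]]] // u _ oddU.
- by rewrite order_map_coef_sum // f0 scale0r; split=> // _; apply: in_center0.
- by rewrite order_map_coef_sum // f0 scale0r; split=> // _; apply: in_center0.
- split=> [_|->]; last by rewrite ffunE scale0r.
  split=> // b _; rewrite -!scalerAl -!scalerAr grassmann_e_even_central //.
  by rewrite oddU.
- split=> [->|_ ->]; last by rewrite ffunE scale0r.
  by rewrite ffunE scale0r; apply: in_center0.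
- split=> [_|_ _ ->]; last by rewrite ffunE scale0r.
  split=> // b _; rewrite -!scalerAl -!scalerAr grassmann_e_even_central //.
  by rewrite oddU.
Qed.

Lemma eval_grassmann f (a : 'I_n -> grassmann F 4) : eval (A := G4 F) f a
  = \sum_(g : {ffun 'I_n -> {set 'I_4}}) (\prod_i a i (g i)) *:
      eval (A := G4 F) f (fun i => grassmann_e F (g i)).
Proof.
rewrite -(eval_multilinear (A := G4 F) (fun S => grassmann_e F S) (fun i => a i)).
by apply: eval_ext => i; apply: grassmann_expand.
Qed.

Lemma G4_central f : coef_sum f = 0 -> order_map F n 3 f = 0 -> is_central (G4 F) f.
Proof.
move=> f0 om3 a _; rewrite eval_grassmann; apply: in_center_sum => g _.
by have [H _] := G4_eval_base g f0; apply: H.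
Qed.

Lemma G4_identity f : coef_sum f = 0 -> order_map F n 2 f = 0 -> order_map F n 4 f = 0 ->
  is_identity (G4 F) f.
Proof.
move=> f0 om2 om4 a _;
have om3 : order_map F n 3 f = 0 by rewrite -dif_order_map om2 linear0.
rewrite eval_grassmann big1 // => g _.
by have [_ ->] := G4_eval_base g f0; rewrite ?scaler0.
Qed.

Lemma order_map_ext0 k f :
  (forall u : {ffun 'I_k -> 'I_n}, injective u -> order_map F n k f u = 0) ->
  order_map F n k f = 0.
Proof.
move=> om0; apply/ffunP => u; rewrite [RHS]ffunE.
have [/injectiveP/om0 //|niu] := boolP (injectiveb u).
by apply: (alt_eq0 charF _ niu); apply/(AltP charF); apply: order_map_Alt.
Qed.

Lemma eval_gen_letters k (le_k4 : (k <= 4)%N) f (u : {ffun 'I_k -> 'I_n}) : injective u ->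
  eval (A := G4 F) f (fun p => grassmann_e F (gen_letters le_k4 u p))
  = order_map F n k f u *: grassmann_e F [set x : 'I_4 | (x < k)%N].
Proof.
move=> inj_u; rewrite order_mapE scaler_suml eval_extend; apply: eq_bigr => s _.
by rewrite (grassmann_word_gen F le_k4 inj_u) scalerA.
Qed.

Lemma G4_identity_order k f : (k <= 4)%N -> is_identity (G4 F) f -> order_map F n k f = 0.
Proof.
move=> le_k4 If; apply: order_map_ext0 => u inj_u.
have /eqP := If (fun p => grassmann_e F (gen_letters le_k4 u p)) (fun _ => isT).
by rewrite eval_gen_letters // scaler_eq0 (negPf (grassmann_e_neq0 _ _)) orbF => /eqP.
Qed.

(** Substituting three generators gives a multiple of e_1 e_2 e_3, which anticommutes with the
    fourth generator with nonzero product; this is where exactly one spare generator is used. *)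
Lemma G4_central_order f : is_central (G4 F) f -> order_map F n 3 f = 0.
Proof.
move=> Cf; apply: order_map_ext0 => u inj_u.
have [_] := Cf (fun p => grassmann_e F (gen_letters (isT : 3 <= 4)%N u p)) (fun _ => isT).
rewrite eval_gen_letters // => /(_ (grassmann_e F [set ord_max]) isT)/eqP.
set U := [set x | _]; have dU : [disjoint U & [set ord_max : 'I_4]].
  by rewrite disjoint_sym disjoints1 inE.
have cardU : #|U| = 3%N.
  have -> : U = ~: [set ord_max].
    by apply/setP => -[[|[|[|[|x]]]] //= ?]; rewrite !inE.
  by rewrite cardsC1 card_ord.
rewrite -scalerAl -scalerAr (grassmann_eC F dU) cardU cards1 muln1 -signr_odd expr1 scaleN1r.
rewrite scalerN -addr_eq0 -mulr2n -scaler_nat !scaler_eq0 (natf_eq0 charF) /=.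
rewrite grassmann_eM dU scaler_eq0 signr_eq0 (negPf (grassmann_e_neq0 _ _)) !orbF.
by move/eqP.
Qed.

End G4.

(** * Identities and central polynomials of the sums, and their characters *)

Section Sums.

Variables (F : fieldType) (n : nat).
Hypothesis charF : [pchar F] =i pred0.
Variables (B : subalg F) (e : 'I_n).
Hypothesis B_marked : forall f,
  (is_identity B f <-> f \in marked_ker F e) /\ (is_central B f <-> f \in marked_ker F e).

Let coef0 f : f \in marked_ker F e -> coef_sum f = 0.
Proof. by rewrite memv_ker => /eqP/marked_coef_sum. Qed.

Let order_kerP k f : reflect (order_map F n k f = 0) (f \in lker (order_map F n k)).
Proof. by rewrite memv_ker; apply: eqP. Qed.

Lemma vsp_Idz_A2 : vsp (Idz_mx (dsum (A2 F) B) n) = marked_ker F e.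
Proof.
apply/vspaceP => f; rewrite mem_vsp; apply/idP/idP => [/Idz_mxP/is_central_dsum[_ Bf]|Kf].
  exact/(B_marked f).2.
apply/Idz_mxP/is_central_dsum; split; last exact/(B_marked f).2.
by apply: (A2_central charF); apply: coef0.
Qed.

Lemma vsp_Id_A2 : vsp (Id_mx (dsum (A2 F) B) n) = (marked_ker F e :&: lker (order_map F n 2))%VS.
Proof.
apply/vspaceP => f; rewrite mem_vsp memv_cap.
apply/idP/andP => [/Id_mxP/is_identity_dsum[Af Bf]|[Kf /order_kerP om2]].
  by split; [apply/(B_marked f).1 | apply/order_kerP; apply: A2_identity_order].
apply/Id_mxP/is_identity_dsum; split; last exact/(B_marked f).1.
by apply: A2_identity => //; apply: coef0.
Qed.

Lemma vsp_Idz_G4 : vsp (Idz_mx (dsum (G4 F) B) n) = (marked_ker F e :&: lker (order_map F n 3))%VS.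
Proof.
apply/vspaceP => f; rewrite mem_vsp memv_cap.
apply/idP/andP => [/Idz_mxP/is_central_dsum[Af Bf]|[Kf /order_kerP om3]].
  by split; [apply/(B_marked f).2 | apply/order_kerP; apply: G4_central_order].
apply/Idz_mxP/is_central_dsum; split; last exact/(B_marked f).2.
by apply: G4_central => //; apply: coef0.
Qed.

Lemma vsp_Id_G4 : vsp (Id_mx (dsum (G4 F) B) n)
  = (marked_ker F e :&: lker (order_map F n 2) :&: lker (order_map F n 4))%VS.
Proof.
apply/vspaceP => f; rewrite mem_vsp !memv_cap.
apply/idP/andP => [/Id_mxP/is_identity_dsum[Af Bf]|[/andP[Kf /order_kerP om2] /order_kerP om4]].
  split; last by apply/order_kerP; apply: G4_identity_order.
  apply/andP; split; first exact/(B_marked f).1.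
  by apply/order_kerP; apply: G4_identity_order.
apply/Id_mxP/is_identity_dsum; split; last exact/(B_marked f).1.
by apply: G4_identity => //; apply: coef0.
Qed.

Hypothesis lt_5n : (5 < n)%N.
(** Keeps [e] off the places 1 to 4 (counted from 0) where letters are exchanged. *)
Hypothesis e_out : (e == 0%N :> nat) || (4 < e)%N.

Local Notation H k := (irr_chi F (n := n) (hook n k 0)).

Lemma cocharacters_sum :
  [/\ chi_z (dsum (A2 F) B) n = H 0 + H 1,
      chi_delta (dsum (A2 F) B) n = H 1 + H 2,
      chi_z (dsum (G4 F) B) n = H 0 + H 1 + H 2
    & chi_delta (dsum (G4 F) B) n = H 1 + H 3 + H 4].
Proof.
have lt_n k : (k < 5)%N -> (k < n)%N by move=> lt_k; exact: leq_trans lt_k (ltnW lt_5n).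
pose p k (lt_k : (k < 5)%N) : 'I_n := Ordinal (lt_n k lt_k).
pose p1 := p 1%N isT; pose p2 := p 2%N isT; pose p3 := p 3%N isT; pose p4 := p 4%N isT.
have ne k lt_k : (0 < k)%N -> p k lt_k != e.
  by move=> k0; apply/eqP => ke; move: e_out; rewrite -ke /=; lia.
have [n1 n2 n3 n4] : [/\ p1 != e, p2 != e, p3 != e & p4 != e] by split; apply: ne.
have E12 : p2 = p1.+1 :> nat by [].
have E23 : p3 = p2.+1 :> nat by [].
have E34 : p4 = p3.+1 :> nat by [].
split.
- exact: (chi_z_marked_ker charF (lt_n 4 isT) vsp_Idz_A2).
- exact: (chi_delta_marked_ker2 charF E12 n1 n2 (lt_n 4 isT) vsp_Idz_A2 vsp_Id_A2).
- exact: (chi_z_marked_ker3 charF E12 n1 n2 (lt_n 4 isT) vsp_Idz_G4).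
- exact: (chi_delta_marked_ker24 charF E12 E23 E34 n1 n2 n3 n4 (lt_n 4 isT) vsp_Idz_G4 vsp_Id_G4).
Qed.

Lemma colengths_sum :
  [/\ l_z (dsum (A2 F) B) n = 2%N, l_delta (dsum (A2 F) B) n = 2%N,
      l_z (dsum (G4 F) B) n = 3%N & l_delta (dsum (G4 F) B) n = 3%N].
Proof.
have lt_n k : (k < 5)%N -> (k < n)%N by move=> lt_k; exact: leq_trans lt_k (ltnW lt_5n).
have [e1 e2 e3 e4] := cocharacters_sum.
have len := @colength_hooks F n charF.
split.
- have := len [:: 0; 1]%N.
  by rewrite /l_z e1 !big_cons big_nil addr0 /= !lt_n // => ->.
- have := len [:: 1; 2]%N.
  by rewrite /l_delta e2 !big_cons big_nil addr0 /= !lt_n // => ->.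
- have := len [:: 0; 1; 2]%N.
  by rewrite /l_z e3 !big_cons big_nil addr0 addrA /= !lt_n // => ->.
- have := len [:: 1; 3; 4]%N.
  by rewrite /l_delta e4 !big_cons big_nil addr0 addrA /= !lt_n // => ->.
Qed.

End Sums.

Theorem lemma5p4 (F : fieldType) (charF : [pchar F] =i pred0) :
  exists N : nat, forall n : nat, (N <= n)%N ->
  [/\ chi_z (dsum (A2 F) (A1 F)) n = irr_chi F [:: n] + irr_chi F [:: n.-1; 1%N]
      /\ chi_z (dsum (A2 F) (A1s F)) n = irr_chi F [:: n] + irr_chi F [:: n.-1; 1%N],
      chi_z (dsum (G4 F) (A1 F)) n
        = irr_chi F [:: n] + irr_chi F [:: n.-1; 1%N] + irr_chi F [:: n.-2; 1%N; 1%N]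
      /\ chi_z (dsum (G4 F) (A1s F)) n
        = irr_chi F [:: n] + irr_chi F [:: n.-1; 1%N] + irr_chi F [:: n.-2; 1%N; 1%N],
      [/\ l_z (dsum (A2 F) (A1 F)) n = 2%N,
          l_z (dsum (A2 F) (A1s F)) n = 2%N,
          l_delta (dsum (A2 F) (A1 F)) n = 2%N
        & l_delta (dsum (A2 F) (A1s F)) n = 2%N]
    & [/\ l_z (dsum (G4 F) (A1 F)) n = 3%N,
          l_z (dsum (G4 F) (A1s F)) n = 3%N,
          l_delta (dsum (G4 F) (A1 F)) n = 3%N
        & l_delta (dsum (G4 F) (A1s F)) n = 3%N]].
Proof.
(* From degree 6 on, the last place, counted from 0, is at least 5 and so lies beyond the four
   exchange places. *)
exists 6%N => -[//|n] lt_5n.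
have h0 : hook n.+1 0 0 = [:: n.+1] by rewrite /hook subn0.
have h1 : hook n.+1 1 0 = [:: n.+1.-1; 1%N] by rewrite /hook subn1.
have h2 : hook n.+1 2 0 = [:: n.+1.-2; 1%N; 1%N] by rewrite /hook subn2.
have last_out : ((ord_max : 'I_n.+1) == 0%N :> nat) || (4 < (ord_max : 'I_n.+1))%N.
  by apply/orP; right; exact: lt_5n.
have first_out : ((ord0 : 'I_n.+1) == 0%N :> nat) || (4 < (ord0 : 'I_n.+1))%N by [].
have [] := cocharacters_sum charF (@A1_marked F n) lt_5n last_out.
have [] := cocharacters_sum charF (@A1s_marked F n) lt_5n first_out.
have [] := colengths_sum charF (@A1_marked F n) lt_5n last_out.
have [] := colengths_sum charF (@A1s_marked F n) lt_5n first_out.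
rewrite -h0 -h1 -h2; by split.
Qed.
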